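(* Let $P\in\mathcal{A}(S)$ and let $\gamma\in\Gamma$ be a non-trivial element. The translation length of $\gamma$ acting on $L_P$, with respect to the relative metric $d$ on $L_P$, is the period $l_P(\gamma)$.
   Context: Basics. $S$ is a closed oriented surface of genus at least $2$, $\Gamma=\pi_1(S)$, $\partial\Gamma$ its Gromov boundary, a circle oriented by the orientation of $S$. A chain $a_1<\dots<a_k$ in $\partial\Gamma$ means distinct and in positive cyclic order ($\le$ allows equality of neighbours); $[a,b]$ is the closed arc from $a$ to $b$ in the positive direction. A nontrivial $\gamma\in\Gamma$ has attracting/repelling fixed points $\gamma^\pm\in\partial\Gamma$. $\mathcal{G}=(\partial\Gamma\times\partial\Gamma)\setminus\Delta$, $\mathcal{G}^\circ=\mathcal{G}\setminus\{(\gamma^-,\gamma^+):\gamma\in\Gamma\setminus\{1\}\}$. A geodesic current is a locally finite $\Gamma$-invariant positive Borel measure on $\mathcal{G}$. Taxi connections. Segments are the sets $s_{x,x';y}=[x,x']\times\{y\}$ ($y<x\le x'<y$, horizontal) and $s_{x;y,y'}=\{x\}\times[y,y']$ ($x<y\le y'<x$, vertical), oriented from first to last point; reversing the order of the two endpoints denotes the negative. $T_1$ is the free abelian group on segments contained in $\mathcal{G}^\circ$ modulo additivity under subdivision; $\partial s$ = endpoint minus starting point, in the free abelian group on $\mathcal{G}^\circ$; $Z_1=\ker\partial\subset T_1$ is the group of taxi cycles. A taxi connection on a principal $\mathbb{R}$-bundle $P$ over $\mathcal{G}^\circ$ (no topology on $P$) is the choice, for each segment $s\subset\mathcal{G}^\circ$,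 of an $\mathbb{R}$-orbit of sections over $s$ (flat sections), compatible with restriction to subsegments. Parallel transport gives its holonomy $h\in\mathrm{Hom}(Z_1,\mathbb{R})$. For a rectangle $r=[x,x']\times[y,y']$ ($x<x'<y<y'$) with boundary in $\mathcal{G}^\circ$ set $\partial r=s_{x;y,y'}+s_{x,x';y'}-s_{x';y,y'}-s_{x,x';y}$. $\mathcal{A}(S)$ is the set of isomorphism classes of $\Gamma$-equivariant principal $\mathbb{R}$-bundles with taxi connection on $\mathcal{G}^\circ$ such that $h(\partial r)\ge 0$ for all such $r$; then there is a unique geodesic current $\mu$, the curvature, with $\mu(r)=h(\partial r)$ for all such $r$. Periods. For nontrivial $\gamma\in\Gamma$, $l_P(\gamma)\in\mathbb{R}$ is the number such that $\gamma\cdot s=s+l_P(\gamma)$ for every flat section $s$ of $P$ over any of the four open rays emanating from $(\gamma^-,\gamma^+)$ (i.e. $\{(\gamma^-,y)\}$ with $\gamma^+<y<\gamma^-$ or $\gamma^-<y<\gamma^+$, and $\{(x,\gamma^+)\}$ with $\gamma^-<x<\gamma^+$ or $\gamma^+<x<\gamma^-$), where $(\gamma\cdot s)(p)=\gamma(s(\gamma^{-1}p))$; it exists and is the same for all four rays. Dual space. Order $\mathcal{G}$ by $(x',y')<(x,y)$ iff $x<x'<y'<y$; $\mathcal{G}_{\le(x,y)}=\{(x',y'):x\le x'<y'\le y\}$ and $\mathcal{G}_{\ge(x,y)}=\{(x',y'):(x,y)\in\mathcal{G}_{\le(x',y')}\}$. A lower submeasure of $\mu$ is a measure $\nu\le\mu$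 such that if $(x,y)\in\operatorname{supp}(\nu)$ then $\nu=\mu$ on $\mathcal{G}_{<(x,y)}$; write $\bar\nu=\mu-\nu$. A monotonic loop $l$ is a closed taxi path in $\mathcal{G}^\circ$ along which both coordinates move weakly in the positive direction, winding once around; $\nu_l$ is $\mu$ on or below $l$ and zero above $l$. $\nu$ is admissible if $\nu-\nu_l$ is a finite (signed) measure. There is a unique $h$ which is the holonomy of an element of $\mathcal{A}(S)$ with curvature $\mu$ (it is the holonomy of $P$). The holonomy of admissible lower submeasures is determined by: $h(\nu_l)=h(l)$ for monotonic taxi loops $l$, and $h(\nu+\epsilon)=h(\nu)+|\epsilon|$ when $\epsilon$ is a finite positive measure of total mass $|\epsilon|$ (with $\nu$, $\nu+\epsilon$ admissible lower submeasures). $X_\mu$ is the set of (admissible) lower submeasures of $\mu$ with holonomy zero, with $\Gamma$ acting by pushforward. The bundle $L_P$. For $\nu\in X_\mu$ let $m_\nu(x,y)=-\nu(\mathcal{G}_{\ge(x,y)})-\bar\nu(\mathcal{G}_{\le(x,y)})$ on $\mathcal{G}^\circ$. $L_P$ is the set of triples $(\nu,v,u)$ with $\nu\in X_\mu$, $v$ a section of $P$ over $\mathcal{G}^\circ$ flat along vertical segments, $u$ a section of $P$ flat along horizontal segments, and $m_\nu=u-v$. It is a principal $\mathbb{R}$-bundle over $X_\mu$ (for each $\nu$ such pairs $(v,u)$ exist and are unique up to a common additive constant), and $\Gamma$ acts on it by $\gamma(\nu,v,u)=(\gamma_*\nu,\gamma\cdot v,\gamma\cdot u)$. For $\mathcal{L}=(\nu,v,u)$,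 $\mathcal{L}'=(\nu',v',u')$ put $f_{\mathcal{L},\mathcal{L}'}(x)=\lim_{y\to x^+}\big(v'(x,y)-v(x,y)\big)$ and $d(\mathcal{L},\mathcal{L}')=\sup_{x\in\partial\Gamma}f_{\mathcal{L},\mathcal{L}'}(x)\in\mathbb{R}$. (It satisfies the triangle inequality, $d(\mathcal{L},\mathcal{L}'+r)=d(\mathcal{L},\mathcal{L}')+r=d(\mathcal{L}-r,\mathcal{L}')$, and $d(\mathcal{L},\mathcal{L}')+d(\mathcal{L}',\mathcal{L})=0$ iff $\mathcal{L},\mathcal{L}'$ lie in the same fiber.) The translation length of $\gamma$ on $L_P$ is $\lim_{n\to\infty}d(\mathcal{L},\gamma^n\mathcal{L})/n$ for any $\mathcal{L}\in L_P$. *)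

(* Defs.v *)
From HB Require Import structures.
From mathcomp Require Import all_boot all_order all_algebra.
From mathcomp Require Import zify.
From mathcomp Require Import all_classical all_reals all_analysis.
Import Order.TTheory GRing.Theory Num.Theory.
Import numFieldNormedType.Exports.

Set Implicit Arguments.
Unset Strict Implicit.
Unset Printing Implicit Defensive.

Local Open Scope classical_set_scope.
Local Open Scope quotient_scope.

(* The fundamental group of a closed oriented surface of genus g >= 2, with
   standard generators a_i, b_i and the single relation prod [a_i, b_i] = 1.
   The last field is the universal property of this presentation. *)
Record surfaceGroup := SurfaceGroup {
  sg_group :> groupType ;
  genus : nat ;
  genus_ge2 : 2 <= genus ;
  sg_a : 'I_genus -> sg_group ;
  sg_b : 'I_genus -> sg_group ;
  sg_letter := fun z : sg_group =>
    exists i, [\/ z = sg_a i, z = sg_b i, z = (sg_a i)^-1%g | z = (sg_b i)^-1%g] ;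
  sg_generated : forall x : sg_group, exists w : seq sg_group,
    (forall z, z \in w -> sg_letter z) /\ x = (\prod_(z <- w) z)%g ;
  sg_relation : (\prod_(i < genus) [~ sg_a i, sg_b i] = 1)%g ;
  sg_universal : forall (H : groupType) (x y : 'I_genus -> H),
    (\prod_(i < genus) [~ x i, y i] = 1)%g ->
    exists f : sg_group -> H,
      [/\ {morph f : u v / (u * v)%g >-> (u * v)%g},
          (forall i, f (sg_a i) = x i) & (forall i, f (sg_b i) = y i)]
}.

Section word_metric.
Variable S : surfaceGroup.
Implicit Types x y z : S.

Definition is_word (n : nat) x := exists w : seq S,
  [/\ size w = n, (forall z, z \in w -> sg_letter z) & x = (\prod_(z <- w) z)%g].

Lemma ex_word x : exists n, `[< is_word n x >].
Proof.
by have [w [Hw xE]] := sg_generated x; exists (size w); apply/asboolP; exists w.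
Qed.

Definition wlen x : nat := ex_minn (ex_word x).
Definition wdist x y : nat := wlen (x^-1 * y)%g.

Lemma wlen_word x : is_word (wlen x) x.
Proof. by rewrite /wlen; case: ex_minnP => n /asboolP. Qed.

Lemma wlen_le n x : is_word n x -> wlen x <= n.
Proof. by move=> H; rewrite /wlen; case: ex_minnP => m _; apply; apply/asboolP. Qed.

Lemma wlenM x y : wlen (x * y)%g <= wlen x + wlen y.
Proof.
have [w [<- Hw xE]] := wlen_word x; have [w' [<- Hw' yE]] := wlen_word y.
apply: wlen_le; exists (w ++ w'); split; first by rewrite size_cat.
  by move=> z; rewrite mem_cat => /orP[/Hw|/Hw'].
by rewrite big_cat /= -xE -yE.
Qed.

Lemma wlen1 : wlen 1%g = 0.
Proof.
by apply/eqP; rewrite -leqn0; apply: wlen_le; exists [::]; rewrite big_nil.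
Qed.

Lemma letterV z : sg_letter z -> sg_letter (z^-1)%g.
Proof.
move=> [i H]; exists i; case: H => ->; rewrite ?invgK;
  by [constructor 1|constructor 2|constructor 3|constructor 4].
Qed.

Lemma wlenV_le x : wlen (x^-1)%g <= wlen x.
Proof.
have [w [<- Hw ->]] := wlen_word x.
elim: w Hw => [|z w IH] Hw; first by rewrite big_nil invg1 wlen1.
rewrite big_cons invgM; apply: (leq_trans (wlenM _ _)).
rewrite addnC /= -add1n; apply: leq_add.
  apply: wlen_le; exists [:: (z^-1)%g]; split => //; last by rewrite big_seq1.
  move=> t; rewrite inE => /eqP ->; apply/letterV/Hw; exact: mem_head.
by apply: IH => t tw; apply: Hw; rewrite inE tw orbT.
Qed.

Lemma wdistC x y : wdist x y = wdist y x.
Proof.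
suff le u v : wdist u v <= wdist v u by apply/eqP; rewrite eqn_leq !le.
by rewrite /wdist; apply: leq_trans (wlenV_le _); rewrite invgM invgK.
Qed.

Lemma wdist_triangle y x z : wdist x z <= wdist x y + wdist y z.
Proof.
have -> : wdist x z = wlen ((x^-1 * y) * (y^-1 * z))%g.
  by rewrite /wdist -mulgA mulVKg.
exact: wlenM.
Qed.

Lemma wdistM g x y : wdist (g * x)%g (g * y)%g = wdist x y.
Proof. by rewrite /wdist invgM -mulgA mulKg. Qed.

(* Gromov's four-point condition. *)
Definition gromov_hyperbolic := exists delta : nat, forall x y z w,
  wdist x z + wdist y w <=
    maxn (wdist x y + wdist z w) (wdist x w + wdist y z) + delta.

Definition geodesic (r : nat -> S) :=
  forall i j, i <= j -> wdist (r i) (r j) = j - i.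

Definition ray := {r : nat -> S | `[< geodesic r >]}.
HB.instance Definition _ := Choice.on ray.

Definition asymp (r r' : ray) : bool :=
  `[< exists K, forall t, wdist (sval r t) (sval r' t) <= K >].

Lemma asymp_refl : reflexive asymp.
Proof. by move=> r; apply/asboolP; exists 0 => t; rewrite /wdist mulVg wlen1. Qed.

Lemma asymp_sym : symmetric asymp.
Proof.
by move=> r s; apply/asboolP/asboolP => -[K H]; exists K => t; rewrite wdistC.
Qed.

Lemma asymp_trans : transitive asymp.
Proof.
move=> s r t /asboolP[K H] /asboolP[K' H']; apply/asboolP; exists (K + K') => n.
by apply: leq_trans (wdist_triangle (sval s n) _ _) _; exact: leq_add.
Qed.

Canonical asymp_equiv := EquivRel asymp asymp_refl asymp_sym asymp_trans.

Definition boundary := {eq_quot asymp}.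
HB.instance Definition _ := Choice.on boundary.

Definition endpoint (r : ray) : boundary := \pi_boundary r.

(* Quotient of the topology of pointwise convergence on geodesic rays. *)
Definition boundary_open (U : set boundary) := forall r : ray, U (endpoint r) ->
  exists n, forall r' : ray, (forall k, k <= n -> sval r' k = sval r k) ->
    U (endpoint r').

Lemma boundary_openT : boundary_open setT.
Proof. by move=> r _; exists 0. Qed.

Lemma boundary_openI A B :
  boundary_open A -> boundary_open B -> boundary_open (A `&` B).
Proof.
move=> oA oB r [/oA[n An] /oB[m Bm]]; exists (maxn n m) => r' E; split.
  by apply: An => k kn; apply: E; rewrite leq_max kn.
by apply: Bm => k kn; apply: E; rewrite leq_max kn orbT.
Qed.

Lemma boundary_open_bigU (I : Type) (f : I -> set boundary) :
  (forall i, boundary_open (f i)) -> boundary_open (\bigcup_i f i).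
Proof. by move=> of_ r [i _ /of_[n H]]; exists n => r' /H ?; exists i. Qed.

HB.instance Definition _ := isOpenTopological.Build boundary
  boundary_openT boundary_openI boundary_open_bigU.

Lemma translate_geodesic (g : S) (r : ray) :
  `[< geodesic (fun t => (g * sval r t)%g) >].
Proof.
by apply/asboolP => i j ij; rewrite wdistM; move/asboolP: (svalP r); apply.
Qed.

Definition translate (g : S) (r : ray) : ray :=
  exist _ (fun t => (g * sval r t)%g) (translate_geodesic g r).

Definition act (g : S) (p : boundary) : boundary := endpoint (translate g (repr p)).

End word_metric.

(* The powers of a_1 form a geodesic ray, as the morphism to Z sending a_1 to 1
   and the other generators to 0 shows; so the boundary is a pointed type, as
   the measure theory library requires. *)
Section basepoint.

Definition Zgrp := int.
HB.instance Definition _ := Choice.on Zgrp.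
Definition Zmul (x y : Zgrp) : Zgrp := (x + y)%R.
Definition Zone : Zgrp := 0%R.
Definition Zinv (x : Zgrp) : Zgrp := (- x)%R.
Fact ZmulA : associative Zmul. Proof. exact: addrA. Qed.
Fact Zmul1 : left_id Zone Zmul. Proof. exact: add0r. Qed.
Fact ZmulV : left_inverse Zone Zinv Zmul. Proof. exact: addNr. Qed.
HB.instance Definition _ := isGroup.Build Zgrp ZmulA Zmul1
  (fun x => addr0 (x : int)) ZmulV (fun x => subrr (x : int)).

Fact Zcommg (x y : Zgrp) : [~ x, y]%g = 1%g.
Proof.
rewrite /commg /conjg (_ : (x * y)%g = (y * x)%g); last exact: (addrC (x : int)).
by rewrite mulKg mulVg.
Qed.

Fact Zabs (x y : Zgrp) : (`|(x * y)%g : int| <= `|x : int| + `|y : int|)%N.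
Proof.
have H (m n : int) : (`|(m + n)%R| <= `|m| + `|n|)%N by lia.
exact: H.
Qed.

Variable S : surfaceGroup.

Lemma base_geodesic : exists z : S, geodesic (fun n => (z ^+ n)%g).
Proof.
pose i0 := Ordinal (ltnW (genus_ge2 S)).
pose x (i : 'I_(genus S)) : Zgrp := if i == i0 then Posz 1 else Posz 0.
have [|f [fM fa fb]] := @sg_universal S Zgrp x (fun=> 1%g).
  by rewrite big1 // => i _; rewrite Zcommg.
have f1 : f 1%g = 1%g by apply: (mulIg (f 1%g)); rewrite -fM !mul1g.
have fV z : f (z^-1)%g = ((f z)^-1)%g.
  by apply: (mulIg (f z)); rewrite -fM !mulVg f1.
have fle z : sg_letter z -> (`|f z : int| <= 1)%N.
  move=> [i]; have xi : (`|x i : int| <= 1)%N by rewrite /x; case: ifP.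
  case=> ->; rewrite ?fV ?fa ?fb //; first by rewrite [absz _]abszN.
have fw z : (`|f z : int| <= wlen z)%N.
  have [w [<- Hw ->]] := wlen_word z.
  elim: w Hw => [|t w IH] Hw; first by rewrite big_nil f1.
  rewrite big_cons fM; have ft := fle t (Hw t (mem_head _ _)).
  have {}IH := IH (fun u uw => Hw u (mem_behead (s := t :: w) uw)).
  exact: leq_trans (Zabs _ _) (leq_add ft IH).
exists (sg_a i0) => i j ij.
have -> : wdist (sg_a i0 ^+ i)%g (sg_a i0 ^+ j)%g = wlen (sg_a i0 ^+ (j - i))%g.
  by rewrite /wdist -{1}(subnKC ij) expgnDr mulKg.
move: (j - i) => n; apply/eqP; rewrite eqn_leq; apply/andP; split.
  apply: wlen_le; exists (nseq n (sg_a i0)); split; first by rewrite size_nseq.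
    by move=> z; rewrite mem_nseq => /andP[_ /eqP ->]; exists i0; constructor 1.
  by rewrite big_nseq; elim: n => //= n <-; rewrite expgS.
apply: leq_trans (fw _).
suff -> : f (sg_a i0 ^+ n)%g = Posz n by [].
elim: n => [|n IH]; first by rewrite expg0 f1.
by rewrite expgS fM IH fa /x eqxx.
Qed.

Definition base_ray : ray S :=
  let: exist z Hz := cid base_geodesic in
  exist (fun r => is_true `[< geodesic r >]) (fun n => (z ^+ n)%g) (asboolT Hz).

HB.instance Definition _ := isPointed.Build (boundary S) (endpoint base_ray).

End basepoint.

(* [fixed_pair g q p]: q and p are the repelling and the attracting fixed
   point of g. *)
Definition fixed_pair (S : surfaceGroup) (g : S) (q p : boundary S) : Prop :=
  [/\ q <> p, act g q = q, act g p = p,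
      (forall z, z <> q -> (fun n => act (g ^+ n)%g z) @ \oo --> p) &
      (forall z, z <> p -> (fun n => act (g ^- n)%g z) @ \oo --> q)].

Definition pairs (S : surfaceGroup) := (boundary S * boundary S)%type.

Definition act2 (S : surfaceGroup) (g : S) (p : pairs S) : pairs S :=
  (act g p.1, act g p.2).

Definition diag (S : surfaceGroup) : set (pairs S) := [set p | p.1 = p.2].

Definition Gcirc (S : surfaceGroup) : set (pairs S) :=
  [set p | p.1 <> p.2 /\ ~ exists2 g : S, g <> 1%g & fixed_pair g p.1 p.2].

(* The space of pairs with its Borel sigma-algebra. A measure on
   G = (pairs S) \ diag is encoded as a measure on it that is null on diag. *)
Definition borel_pairs (S : surfaceGroup) :=
  g_sigma_algebraType (@open (boundary S * boundary S)%type).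

Section orientation.
Variables (R : realType) (S : surfaceGroup).

Definition unit_circle : set (R * R) := [set p | p.1 ^+ 2 + p.2 ^+ 2 = 1]%R.

Definition ccw (p q r : R * R) : Prop :=
  (0 < (q.1 - p.1) * (r.2 - p.2) - (q.2 - p.2) * (r.1 - p.1))%R.

(* [C x y z] says that x, y, z are distinct and in positive cyclic order.
   Both orientations of the circle satisfy this predicate; they come from the
   two orientations of the surface. *)
Definition boundary_orientation
    (C : boundary S -> boundary S -> boundary S -> Prop) : Prop :=
  (exists phi : boundary S -> R * R,
    [/\ injective phi,
        range phi = unit_circle,
        (forall U, open U <-> exists2 V, open V & U = phi @^-1` V) &
        (forall x y z, C x y z <-> ccw (phi x) (phi y) (phi z))]) /\
  (forall (g : S) x y z, C x y z -> C (act g x) (act g y) (act g z)).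

End orientation.

Section taxi.
Variables (S : surfaceGroup) (C : boundary S -> boundary S -> boundary S -> Prop).
Local Notation B := (boundary S).
Local Notation BB := (pairs S).
Implicit Types (x y z : B) (p q : BB) (A : set BB).

(* a <= b in the linear order obtained by cutting the circle before x *)
Definition cle x a b : Prop := [\/ a = x, a = b | C x a b].

Definition chain4 a b c d : Prop := C a b c /\ C a c d.

Definition carc a b : set B := [set z | [\/ z = a, z = b | C a z b]].

Definition carc_co a b : set B := [set z | (z = a /\ a <> b) \/ C a z b].

(* x <= x' < y' <= y *)
Definition G_le p : set BB :=
  [set q | [/\ cle p.1 q.1 q.2, q.1 <> q.2 & cle p.1 q.2 p.2]].

Definition G_ge p : set BB := [set q | q.1 <> q.2 /\ G_le q p].

(* x < x' < y' < y *)
Definition G_lt p : set BB := [set q | chain4 p.1 q.1 q.2 p.2].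

Inductive hsegment : BB -> BB -> set BB -> Prop :=
  HSegment x x' y : x <> y -> x' <> y -> (x = x' \/ C y x x') ->
    hsegment (x, y) (x', y) (carc x x' `*` [set y]).

Inductive vsegment : BB -> BB -> set BB -> Prop :=
  VSegment x y y' : y <> x -> y' <> x -> (y = y' \/ C x y y') ->
    vsegment (x, y) (x, y') ([set x] `*` carc y y').

(* A is a segment oriented from p to q *)
Definition segment p q A : Prop := hsegment p q A \/ vsegment p q A.

(* A sequence of corners p :: s is a monotonic taxi loop: it is closed, its
   steps are positively oriented segments in Gcirc, and each coordinate winds
   once around, i.e. the half-open arcs it traverses partition the circle. *)
Definition corner (p : BB) (s : seq BB) (i : nat) : BB := nth p (p :: s) i.

Definition monotonic_loop (p : BB) (s : seq BB) : Prop :=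
  [/\ last p s = p,
      (forall i, i < size s -> exists2 A,
         segment (corner p s i) (corner p s i.+1) A & A `<=` @Gcirc S),
      (forall z, exists! i, i < size s /\
         carc_co (corner p s i).1 (corner p s i.+1).1 z) &
      (forall z, exists! i, i < size s /\
         carc_co (corner p s i).2 (corner p s i.+1).2 z)].

Definition loop_image (p : BB) (s : seq BB) : set BB :=
  [set q | exists i A, [/\ i < size s,
     segment (corner p s i) (corner p s i.+1) A & A q]].

Definition on_or_below (p : BB) (s : seq BB) : set BB :=
  [set q | exists2 q', loop_image p s q' & G_le q' q].

Section bundle.
Variable R : realType.

(* A Gamma-equivariant principal R-bundle over Gcirc with a taxi connection.
   [flat A s] says that s restricts to a flat section over the segment A; the
   values of s outside A and of flat on other sets are irrelevant. *)
Record taxiBundle := TaxiBundle {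
  total :> Type ;
  bproj : total -> BB ;
  fshift : total -> R -> total ;
  lift_act : S -> total -> total ;
  flat : set BB -> (BB -> total) -> Prop ;
  proj_circ : forall e, Gcirc (bproj e) ;
  proj_surj : forall p, Gcirc p -> exists e, bproj e = p ;
  proj_shift : forall e c, bproj (fshift e c) = bproj e ;
  shift0 : forall e, fshift e 0%R = e ;
  shiftD : forall e c d, fshift (fshift e c) d = fshift e (c + d)%R ;
  shift_free : forall e c, fshift e c = e -> c = 0%R ;
  shift_trans : forall e e', bproj e = bproj e' -> exists c, e' = fshift e c ;
  lift_act1 : forall e, lift_act 1%g e = e ;
  lift_actM : forall g h e, lift_act (g * h)%g e = lift_act g (lift_act h e) ;
  proj_act : forall g e, bproj (lift_act g e) = act2 g (bproj e) ;
  shift_act : forall g e c, lift_act g (fshift e c) = fshift (lift_act g e) c ;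
  is_segment := fun A => (exists p q, segment p q A) /\ A `<=` @Gcirc S ;
  flat_ex : forall A, is_segment A -> exists s, flat A s ;
  flat_proj : forall A s, is_segment A -> flat A s ->
    forall p, A p -> bproj (s p) = p ;
  flat_orbit : forall A s s', is_segment A -> flat A s ->
    (flat A s' <-> exists c, forall p, A p -> s' p = fshift (s p) c) ;
  flat_restr : forall A A' s, is_segment A -> is_segment A' -> A' `<=` A ->
    flat A s -> flat A' s ;
  flat_act : forall g A s, is_segment A -> flat A s ->
    flat (act2 g @` A) (fun p => lift_act g (s (act2 (g^-1)%g p)))
}.

Variable P : taxiBundle.

(* e' - e, for e and e' in the same fiber *)
Definition sub_fiber (e' e : P) : R := xget 0%R [set c | e' = fshift e c].

Definition act_section (g : S) (s : BB -> P) : BB -> P :=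
  fun p => lift_act g (s (act2 (g^-1)%g p)).

Definition is_section (A : set BB) (s : BB -> P) : Prop :=
  forall p, A p -> bproj (s p) = p.

Definition flat_section (A : set BB) (s : BB -> P) : Prop :=
  is_section A s /\
  forall p q A', segment p q A' -> A' `<=` A -> A' `<=` @Gcirc S -> flat A' s.

Definition vertical_flat (v : BB -> P) : Prop := is_section (@Gcirc S) v /\
  forall p q A, vsegment p q A -> A `<=` @Gcirc S -> flat A v.

Definition horizontal_flat (u : BB -> P) : Prop := is_section (@Gcirc S) u /\
  forall p q A, hsegment p q A -> A `<=` @Gcirc S -> flat A u.

(* e' is the parallel transport of e along a segment in Gcirc, traversed in
   the positive or in the negative direction *)
Definition parallel (e e' : P) : Prop := exists A s,
  [/\ segment (bproj e) (bproj e') A \/ segment (bproj e') (bproj e) A,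
      A `<=` @Gcirc S, flat A s, s (bproj e) = e & s (bproj e') = e'].

(* parallel transport along the taxi path with corners bproj e :: s *)
Fixpoint transport (e : P) (s : seq BB) (e' : P) : Prop :=
  if s is q :: s' then
    exists e1, [/\ bproj e1 = q, parallel e e1 & transport e1 s' e']
  else e' = e.

(* c is the holonomy of the closed taxi path with corners p :: s *)
Definition taxi_holonomy (p : BB) (s : seq BB) (c : R) : Prop :=
  exists2 e : P, bproj e = p & transport e s (fshift e c).

(* r = [x, x'] x [y, y'] is a rectangle with boundary in Gcirc *)
Definition admissible_rectangle x x' y y' : Prop :=
  [/\ chain4 x x' y y',
      [set x] `*` carc y y' `<=` @Gcirc S, [set x'] `*` carc y y' `<=` @Gcirc S,
      carc x x' `*` [set y] `<=` @Gcirc S & carc x x' `*` [set y'] `<=` @Gcirc S].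

Definition rectangle_holonomy x x' y y' (c : R) : Prop :=
  taxi_holonomy (x, y) [:: (x, y'); (x', y'); (x', y); (x, y)] c.

Definition nonneg_holonomy : Prop := forall x x' y y' c,
  admissible_rectangle x x' y y' -> rectangle_holonomy x x' y y' c -> (0 <= c)%R.

Local Open Scope ring_scope.
Local Open Scope ereal_scope.

Definition is_curvature (mu : {measure set (borel_pairs S) -> \bar R}) : Prop :=
  forall x x' y y' c, admissible_rectangle x x' y y' ->
    rectangle_holonomy x x' y y' c -> mu (carc x x' `*` carc y y') = c%:E.

(* the four open rays emanating from (q, p) *)
Definition ray4 (q p : B) (A : set BB) : Prop :=
  [\/ A = [set z | z.1 = q /\ C p z.2 q],
      A = [set z | z.1 = q /\ C q z.2 p],
      A = [set z | C q z.1 p /\ z.2 = p] |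
      A = [set z | C p z.1 q /\ z.2 = p]].

Definition is_period (g : S) (l : R) : Prop := exists q p : B, fixed_pair g q p /\
  forall A s, ray4 q p A -> flat_section A s ->
    forall z : BB, A z -> act_section g s z = fshift (s z) l.

(* Measures on G are handled as set functions; only their values on Borel sets
   matter. *)
Definition is_measure (nu : set BB -> \bar R) : Prop :=
  exists m : {measure set (borel_pairs S) -> \bar R},
    forall A : set (borel_pairs S), measurable A -> nu A = m A.

Definition msupport (nu : set BB -> \bar R) : set BB :=
  [set p | p.1 <> p.2 /\ forall U : set BB, open U -> U p -> 0 < nu U].

Variable mu : {measure set (borel_pairs S) -> \bar R}.

Definition lower_submeasure (nu : set BB -> \bar R) : Prop :=
  [/\ is_measure nu,
      (forall A : set (borel_pairs S), measurable A -> nu A <= mu A) &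
      (forall p, msupport nu p -> forall A : set (borel_pairs S),
         measurable A -> A `<=` G_lt p -> nu A = mu A)].

Definition loop_measure (p : BB) (s : seq BB) : set BB -> \bar R :=
  fun A => mu (A `&` on_or_below p s).

(* The finite signed measure nu - nu_l does not make sense setwise where both
   terms are infinite; hence the additive form. *)
Definition admissible (nu : set BB -> \bar R) : Prop :=
  exists p s (rho : {charge set (borel_pairs S) -> \bar R}),
    monotonic_loop p s /\
    forall A : set (borel_pairs S), measurable A ->
      nu A = loop_measure p s A + rho A.

Definition admissible_lower (nu : set BB -> \bar R) : Prop :=
  lower_submeasure nu /\ admissible nu.

(* nu' = nu + eps with eps a finite positive measure of total mass c *)
Definition finite_increment (nu nu' : set BB -> \bar R) (c : R) : Prop :=
  exists eps : {measure set (borel_pairs S) -> \bar R}, eps setT = c%:E /\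
    forall A : set (borel_pairs S), measurable A -> nu' A = nu A + eps A.

(* The holonomy of admissible lower submeasures, as a relation: the least one
   closed under the rules h(nu_l) = h(l) and h(nu + eps) = h(nu) + |eps|. *)
Inductive submeasure_holonomy : (set BB -> \bar R) -> R -> Prop :=
| Hol_loop p s c : monotonic_loop p s -> taxi_holonomy p s c ->
    submeasure_holonomy (loop_measure p s) c
| Hol_incr nu nu' c d : admissible_lower nu -> admissible_lower nu' ->
    finite_increment nu nu' d ->
    submeasure_holonomy nu c -> submeasure_holonomy nu' (c + d)%R
| Hol_decr nu nu' c d : admissible_lower nu -> admissible_lower nu' ->
    finite_increment nu nu' d ->
    submeasure_holonomy nu' c -> submeasure_holonomy nu (c - d)%R.

Definition X_mu (nu : set BB -> \bar R) : Prop :=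
  admissible_lower nu /\ submeasure_holonomy nu 0%R.

Record triple := Triple {
  tr_nu : set BB -> \bar R ;
  tr_v : BB -> P ;
  tr_u : BB -> P
}.

(* nubar is mu - nu, and the real number m is m_nu(p) *)
Definition in_LP (L : triple) : Prop :=
  [/\ X_mu (tr_nu L), vertical_flat (tr_v L), horizontal_flat (tr_u L) &
      exists nubar : {measure set (borel_pairs S) -> \bar R},
        (forall A : set (borel_pairs S), measurable A ->
           mu A = tr_nu L A + nubar A) /\
        forall p, Gcirc p -> exists2 m : R,
          m%:E = - tr_nu L (G_ge p) - nubar (G_le p) &
          tr_u L p = fshift (tr_v L p) m].

Definition act_triple (g : S) (L : triple) : triple :=
  Triple (fun A => tr_nu L (act2 g @^-1` A))
         (act_section g (tr_v L)) (act_section g (tr_u L)).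

(* y -> x from the positive side *)
Definition right_filter (x : B) : set_system B :=
  [set A | exists2 z, z <> x & forall y, C x y z -> A y].

Definition f_LP (L L' : triple) (x : B) : R :=
  lim ((fun y => sub_fiber (tr_v L' (x, y)) (tr_v L (x, y))) @ right_filter x).

Definition d_LP (L L' : triple) : \bar R :=
  ereal_sup [set (f_LP L L' x)%:E | x in [set: B]].

Definition is_translation_length (g : S) (l : R) : Prop :=
  forall L : triple, in_LP L ->
    (fun n : nat => d_LP L (act_triple (g ^+ n)%g L) * (n%:R^-1)%:E) @ \oo --> l%:E.

End bundle.
End taxi.

Local Open Scope ring_scope.

Definition geodesic_current (R : realType) (S : surfaceGroup)
    (mu : {measure set (borel_pairs S) -> \bar R}) : Prop :=
  [/\ mu (@diag S) = 0%E,
      (forall (g : S) (A : set (borel_pairs S)), measurable A ->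
         mu (act2 g @^-1` A) = mu A) &
      (forall p : pairs S, p.1 <> p.2 -> exists U : set (pairs S),
         [/\ open U, U p & (mu U < +oo)%E])].

(* Main.v *)
Require Import Defs.
From HB Require Import structures.
From mathcomp Require Import all_boot all_order all_algebra.
From mathcomp Require Import ring lra zify.
From mathcomp Require Import all_classical all_reals all_analysis.
Import Order.TTheory GRing.Theory Num.Theory.
Import numFieldNormedType.Exports.

(* For k = g^n the sections k.v and v differ at p by a number D(p). It is
   constant on vertical segments, and since u = v + m_nu, the sum of D and
   m_nu o k^-1 - m_nu is constant on horizontal ones. Let q, r be the repelling
   and attracting points of g; on both vertical rays over q, D is n l, so
   d(L, kL) >= n l. For x between q and r choose y fixed between r and q and
   not fixed by any group element, and compare D at (x, y) and (q, y) along a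
   horizontal segment. The difference is a combination of masses of strips
   attached to (x, y) and of their images under k^-1; as k^-1 pushes x and y
   towards q, the strips of one kind shrink, so that what remains is at most
   the mass nubar(G_<=(q, y)), which depends neither on x nor on n. For x
   between r and q the same argument works with nu(G_>=(q, y)). Hence
   n l <= d(L, kL) <= n l + K. Points x fixed by group elements, where vertical
   lines meet the complement of Gcirc, are limits from the right of points
   fixed by none, and D passes to the limit by continuity from above of nu and
   nubar. That the vertical rays lie in Gcirc, without which the flat sections
   in the definition of the period would not exist, is the discreteness
   statement that two elements with the same repelling point have the same
   attracting point. *)

Set Implicit Arguments.
Unset Strict Implicit.
Unset Printing Implicit Defensive.

Local Open Scope classical_set_scope.
Local Open Scope quotient_scope.

(** * The action on the boundary *)

Section boundary_action.
Variable S : surfaceGroup.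
Implicit Types (g h : S) (r : ray S) (x y z : boundary S).

Lemma endpointP r r' : endpoint r = endpoint r' <-> asymp r r'.
Proof. by split => [/eqmodP|H]; last exact/eqmodP. Qed.

Lemma endpoint_repr x : endpoint (repr x) = x.
Proof. exact: reprK. Qed.

Lemma act_endpoint g r : act g (endpoint r) = endpoint (translate g r).
Proof.
apply/endpointP/asboolP.
have /endpointP/asboolP[K HK] := endpoint_repr (endpoint r).
by exists K => t /=; rewrite wdistM; exact: HK.
Qed.

Lemma act1 x : act 1%g x = x.
Proof.
rewrite -[x]endpoint_repr act_endpoint; apply/endpointP/asboolP.
by exists 0 => t /=; rewrite mul1g /wdist mulVg wlen1.
Qed.

Lemma actM g h x : act (g * h)%g x = act g (act h x).
Proof.
rewrite -[x]endpoint_repr !act_endpoint; apply/endpointP/asboolP.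
by exists 0 => t /=; rewrite mulgA /wdist mulVg wlen1.
Qed.

Lemma actK g : cancel (act g) (act g^-1%g).
Proof. by move=> x; rewrite -actM mulVg act1. Qed.

Lemma actKV g : cancel (act g^-1%g) (act g).
Proof. by move=> x; rewrite -actM mulgV act1. Qed.

Lemma act_inj g : injective (act g).
Proof. exact: can_inj (actK g). Qed.

Lemma act_expg_fix g x n : act g x = x -> act (g ^+ n)%g x = x.
Proof. by move=> gx; elim: n => [|n IH]; rewrite ?expg0 ?act1 // expgS actM IH. Qed.

Lemma actV_fix g x : act g x = x -> act g^-1%g x = x.
Proof. by move=> gx; rewrite -{1}gx actK. Qed.

(* With E t T := d (r t) (r' T) + t - T, which is antitone
   in T and monotone in t, the eventual value of E t is eventually constant in
   t; hence r t and r' s both lie on geodesics from r t0 to r' T, and the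
   four-point condition applies. *)
Lemma asymp_shift : gromov_hyperbolic S -> exists D, forall r r', asymp r r' ->
  exists a b, forall t, wdist (sval r (t + a)) (sval r' (t + b)) <= D.
Proof.
move=> [D HD]; exists D => r r' /asboolP[K HK].
have /asboolP gr := svalP r; have /asboolP gr' := svalP r'.
pose d t T := wdist (sval r t) (sval r' T).
(* The summand [K] keeps the natural subtraction from truncating, by [dlo]. *)
pose E t T := d t T + t + K - T.
have dlo t T : T <= d t T + t + K.
  case: (leqP T t) => [|/ltnW tT]; first lia.
  have := wdist_triangle (sval r t) (sval r' t) (sval r' T).
  by rewrite (gr' _ _ tT) (wdistC (sval r' t)) /d; have := HK t; lia.
have dup t T : t <= T -> d t T + t <= K + T.
  move=> tT; have := wdist_triangle (sval r' t) (sval r t) (sval r' T).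
  by rewrite (gr' _ _ tT) /d; have := HK t; lia.
have ET t T T' : T <= T' -> E t T' <= E t T.
  move=> TT; have := wdist_triangle (sval r' T) (sval r t) (sval r' T').
  by rewrite (gr' _ _ TT) /E /d; lia.
have Et t t' T : t <= t' -> E t T <= E t' T.
  move=> tt; have := wdist_triangle (sval r t') (sval r t) (sval r' T).
  by rewrite (gr _ _ tt) /E /d; lia.
have lim t : exists b T1, forall T, T1 <= T -> E t T = b.
  have [|b /asboolP[T0 bE] bmin] :=
    @ex_minnP (fun b => `[< exists T, E t T = b >]).
    by exists (E t 0); apply/asboolP; exists 0.
  exists b, T0 => T TT; apply/eqP; rewrite eqn_leq -{1}bE ET //=.
  by apply: bmin; apply/asboolP; exists T.
pose Q b := `[< exists t T1, forall T, T1 <= T -> E t T = b >].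
have exQ : exists b, Q b.
  by have [b [T1 H]] := lim 0; exists b; apply/asboolP; exists 0, T1.
have ubQ b : Q b -> b <= K + K.
  move=> /asboolP[t [T1 H]]; rewrite -(H (maxn t T1)) ?leq_maxr //.
  by have := dup t (maxn t T1) (leq_maxl _ _); rewrite /E; lia.
have [b /asboolP[t0 [T0 H0]] bmax] := ex_maxnP exQ ubQ.
(* With these offsets [E t0 s = b] says that [r' s] is as far from [r t0] as [r t] is. Both pairs of
   sums in the four-point condition then equal the distance from [r t0] to [r' T], which leaves only
   [D]. *)
exists (t0 + T0 + b), (t0 + T0 + K) => tau.
set t := tau + _; set s := tau + _.
have [b' [T1 H1]] := lim t.
pose T := maxn T0 (maxn T1 s).
have TT0 : T0 <= T by rewrite leq_maxl.
have TT1 : T1 <= T by rewrite !leq_max leqnn orbT.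
have Ts : s <= T by rewrite !leq_max leqnn !orbT.
have b'E : b' = b.
  apply/eqP; rewrite eqn_leq bmax; last by apply/asboolP; exists t, T1.
  by rewrite -(H0 T TT0) -(H1 T TT1); apply: Et; rewrite /t; lia.
have e1 := H0 T TT0; have e2 := H1 T TT1.
have e3 : E t0 s = b by apply: H0; rewrite /s; lia.
have tt0 : t0 <= t by rewrite /t; lia.
have := HD (sval r t0) (sval r t) (sval r' T) (sval r' s).
rewrite (gr _ _ tt0) (wdistC (sval r' T)) (gr' _ _ Ts) -!/(d _ _).
move: e1 e2 e3 (dlo t0 T) (dlo t T) (dlo t0 s); rewrite b'E /E.
by move: (d _ _) (d _ _) (d _ _) (d _ _) => d1 d2 d3 d4; rewrite /t /s; lia.
Qed.

Lemma finite_letter : finite_set (@sg_letter S).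
Proof.
apply: (@sub_finite_set _ _ (range (@sg_a S) `|` range (@sg_b S) `|`
  range (fun i => (sg_a (s := S) i)^-1%g) `|` range (fun i => (sg_b (s := S) i)^-1%g))).
  move=> z [i [] ->]; [do 3 left|do 2 left; right|left; right|right]; by exists i.
by rewrite !finite_setU; repeat split; apply: finite_image; exact: finite_finset.
Qed.

Lemma finite_ball n : finite_set [set x : S | wlen x <= n].
Proof.
elim: n => [|n IH].
  apply: (@sub_finite_set _ _ [set 1%g]); last exact: finite_set1.
  move=> x /= x0; have [w [sw _ ->]] := wlen_word x.
  by move: sw; move: x0; rewrite leqn0 => /eqP -> /size0nil ->; rewrite big_nil.
apply: (@sub_finite_set _ _ ([set 1%g] `|`
  [set (z * x)%g | z in @sg_letter S & x in [set x : S | wlen x <= n]])); last first.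
  by rewrite finite_setU; split; [exact: finite_set1 | exact: finite_image2 finite_letter IH].
move=> x /= xn; have [[|z w] [sw Hw ->]] := wlen_word x.
  by left; rewrite big_nil.
right; exists z; first by apply: Hw; exact: mem_head.
exists (\prod_(t <- w) t)%g; last by rewrite big_cons.
move: sw => /= sw; apply: (@leq_trans (size w)); last by lia.
by apply: wlen_le; exists w; split => // t tw; apply: Hw; rewrite inE tw orbT.
Qed.

(** Far out on a ray to [x], every [g ^+ n] and [h] act as shifts up to the constant [D] of
    [asymp_shift], which depends on neither element. Hence the conjugated commutators [e n] all lie
    in one finite ball, and two of them coincide. *)
Lemma commuting_power g h x : gromov_hyperbolic S -> act g x = x -> act h x = x ->
  exists2 j, 0 < j & commute (g ^+ j)%g h.
Proof.
move=> /asymp_shift[D HD] gx hx.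
pose r := repr x.
have shift k : act k x = x ->
    exists a b, forall t, wdist (k * sval r (t + a))%g (sval r (t + b)) <= D.
  move=> kx; have : asymp (translate k r) r.
    by apply/endpointP; rewrite -act_endpoint endpoint_repr.
  by move=> /HD.
have [a [b Hab]] := shift h hx.
have near n : exists T, forall s, T <= s ->
    wdist (h * (g ^+ n * sval r s))%g (g ^+ n * (h * sval r s))%g <= 4 * D.
  have [a' [b' Hab']] := shift _ (act_expg_fix n gx).
  exists (a + a') => s /subnK <-; set t := s - _.
  have tri (x1 x2 x3 x4 x5 : S) : wdist x1 x2 <= D -> wdist x2 x3 <= D ->
      wdist x4 x3 <= D -> wdist x5 x4 <= D -> wdist x1 x5 <= 4 * D.
    rewrite (wdistC x4) (wdistC x5) => H1 H2 H3 H4.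
    have := wdist_triangle x2 x1 x5; have := wdist_triangle x3 x2 x5.
    by have := wdist_triangle x4 x3 x5; lia.
  (* The path goes from [h g^n r] through [h r], [r] and [g^n r] to [g^n h r]; each leg shifts the
     parameter along the ray and costs at most [D]. *)
  apply: (tri _ (h * sval r (t + a + b'))%g (sval r (t + b + b'))
    (g ^+ n * sval r (t + a' + b))%g).
  - by rewrite wdistM addnA; exact: Hab'.
  - by rewrite (addnAC t a) (addnAC t b); exact: Hab.
  - by rewrite (addnAC t a'); exact: Hab'.
  - by rewrite wdistM (addnC a) addnA; exact: Hab.
have /finite_seqP[s sE] := finite_ball (4 * D).
(* The pigeonhole argument needs one more exponent than the ball has elements, so finitely many
   thresholds suffice and a common [T] exists. *)
have [T HT] : exists T, forall n, n <= size s -> forall t, T <= t ->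
    wdist (h * (g ^+ n * sval r t))%g (g ^+ n * (h * sval r t))%g <= 4 * D.
  elim: (size s) => [|N [T HT]].
    by have [T HT] := near 0; exists T => n; rewrite leqn0 => /eqP ->.
  have [T' HT'] := near N.+1; exists (maxn T T') => n.
  rewrite leq_eqVlt => /orP[/eqP ->|nN] t; rewrite geq_max => /andP[t1 t2].
    exact: HT'.
  exact: HT.
pose e n : S := ((h * (g ^+ n * sval r T))^-1 * (g ^+ n * (h * sval r T)))%g.
have es n : n <= size s -> e n \in s.
  move=> nN; have : [set x | wlen x <= 4 * D] (e n) by exact: HT.
  by rewrite sE.
have [i [j [ij eij]]] : exists i j, i < j /\ e i = e j.
  apply: contrapT => H.
  have : uniq [seq e n | n <- iota 0 (size s).+1].
    rewrite map_inj_in_uniq ?iota_uniq // => i j _ _ eij.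
    by case: (ltngtP i j) => // ij; case: H; [exists i, j|exists j, i].
  move=> /uniq_leq_size Hs; suff /Hs : {subset [seq e n | n <- iota 0 (size s).+1] <= s}.
    by rewrite size_map size_iota ltnn.
  by move=> y /mapP[n]; rewrite mem_iota /= add0n ltnS => nN ->; exact: es.
exists (j - i); first by rewrite subn_gt0.
(* Cancelling the common outer factors leaves [h^-1 = g^-k h^-1 g^k]. *)
move: eij; rewrite /e -(subnK (ltnW ij)) addnK; set k := j - i.
rewrite expgnDr !invgM !mulgA => /mulIg /mulIg.
rewrite -!mulgA => /mulgI.
rewrite !mulgA => /mulIg; rewrite -!mulgA => /mulgI E.
have {}E : (h^-1 = (g ^+ k)^-1 * (h^-1 * g ^+ k))%g by [].
apply: (mulgI h^-1%g); apply: (mulIg h^-1%g).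
by rewrite mulKg !mulgA mulgK [in RHS]E mulVKg.
Qed.

End boundary_action.

(** * Coordinates on the circle *)

Section cyclic_order.
Local Open Scope ring_scope.
Variable R : realType.
Implicit Types a b c d s t : R.

Definition cyc a b c : Prop :=
  a < b /\ b < c \/ (b < c /\ c < a \/ c < a /\ a < b).

(* Inverse of the stereographic projection from the point (c, s). *)
Definition circle_pt c s t : R * R :=
  ((c * (t ^+ 2 - 1) + 2 * s * t) / (1 + t ^+ 2),
   (s * (t ^+ 2 - 1) - 2 * c * t) / (1 + t ^+ 2)).

(** If [theta] is the angle from (c, s) to (u, w), the parameter is [-cot (theta / 2)], which
    increases as the point runs once around in the positive direction. Here [X] is [1 - cos theta]
    and [Y] is [- sin theta]. *)
Lemma circle_ptP c s u w : c ^+ 2 + s ^+ 2 = 1 -> u ^+ 2 + w ^+ 2 = 1 ->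
  (u, w) <> (c, s) ->
  (u, w) = circle_pt c s ((s * u - c * w) / (1 - (c * u + s * w))).
Proof.
move=> cs uw neq; set X := 1 - _; set Y := s * u - _.
have X0 : X != 0.
  apply/eqP => X0; apply: neq.
  have : (u - c) ^+ 2 + (w - s) ^+ 2 = 2 * X.
    by rewrite /X; lra.
  rewrite X0 mulr0 => /eqP; rewrite paddr_eq0 ?sqr_ge0 // !sqrf_eq0 !subr_eq0.
  by move=> /andP[/eqP -> /eqP ->].
set t := Y / X.
have tX : t * X = Y by rewrite /t divfK.
have t0 : 1 + t ^+ 2 != 0 by rewrite gt_eqF //; nra.
have Y2 : Y ^+ 2 = X * (2 - X).
  have : Y ^+ 2 + (1 - X) ^+ 2 = (c ^+ 2 + s ^+ 2) * (u ^+ 2 + w ^+ 2).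
    by rewrite /X /Y; ring.
  by rewrite cs uw; lra.
have t2 : t ^+ 2 * X = 2 - X.
  by apply: (mulfI X0); rewrite -Y2 -tX; ring.
have tc : (1 + t ^+ 2) * X = 2 by rewrite mulrDl t2; ring.
rewrite /circle_pt; congr pair; apply: (mulIf t0); rewrite divfK //;
  apply: (mulIf X0); rewrite -mulrA tc.
  have -> : (c * (t ^+ 2 - 1) + 2 * s * t) * X =
    c * (t ^+ 2 * X - X) + 2 * s * (t * X) by ring.
  rewrite t2 tX /X /Y; transitivity (2 * (c ^+ 2 + s ^+ 2) * u); last by ring.
  by rewrite cs; ring.
have -> : (s * (t ^+ 2 - 1) - 2 * c * t) * X =
    s * (t ^+ 2 * X - X) - 2 * c * (t * X) by ring.
rewrite t2 tX /X /Y; transitivity (2 * (c ^+ 2 + s ^+ 2) * w); last by ring.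
by rewrite cs; ring.
Qed.

Lemma ccw_base c s a b : c ^+ 2 + s ^+ 2 = 1 ->
  ccw (c, s) (circle_pt c s a) (circle_pt c s b) <-> a < b.
Proof.
move=> cs.
have a0 : 0 < 1 + a ^+ 2 by nra.
have b0 : 0 < 1 + b ^+ 2 by nra.
have a1 := lt0r_neq0 a0; have b1 := lt0r_neq0 b0.
rewrite /ccw /=.
set e := (X in 0 < X).
have -> : e = 4 * (c ^+ 2 + s ^+ 2) / ((1 + a ^+ 2) * (1 + b ^+ 2)) * (b - a).
  by rewrite /e; field; rewrite a1 b1.
by rewrite cs pmulr_rgt0 ?subr_gt0 // divr_gt0 ?mulr_gt0.
Qed.

(** The product is a Vandermonde determinant, invariant under cyclic permutations; up to a positive
    factor it is the determinant in [ccw] for three points of the circle. *)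
Lemma cyc_prod a b d : cyc a b d <-> 0 < (b - a) * (d - b) * (d - a).
Proof.
have pos (x y z : R) : 0 < x -> 0 < y -> 0 < z -> 0 < x * y * z.
  by move=> x0 y0 z0; rewrite !mulr_gt0.
split=> [[|[]][? ?]|H].
- by apply: pos; lra.
- by rewrite [ltRHS](_ : _ = (a - b) * (d - b) * (a - d)); [apply: pos; lra|ring].
- by rewrite [ltRHS](_ : _ = (b - a) * (b - d) * (a - d)); [apply: pos; lra|ring].
have neg (x y z : R) : 0 < x -> 0 < y -> 0 < z ->
  (b - a) * (d - b) * (d - a) = - (x * y * z) -> False.
  by move=> x0 y0 z0 E; have := pos _ _ _ x0 y0 z0; lra.
rewrite /cyc.
have [ab|ba|ab] := ltrgtP a b; last by move: H; rewrite ab subrr !mul0r ltxx.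
  have [bd|db|bd] := ltrgtP b d; last by move: H; rewrite bd subrr mulr0 mul0r ltxx.
    by left.
  have [ad|da|ad] := ltrgtP a d; last by move: H; rewrite ad subrr mulr0 ltxx.
    by exfalso; apply: (neg (b - a) (b - d) (d - a)); [lra..|ring].
  by right; right.
have [bd|db|bd] := ltrgtP b d; last by move: H; rewrite bd subrr mulr0 mul0r ltxx.
  have [ad|da|ad] := ltrgtP a d; last by move: H; rewrite ad subrr mulr0 ltxx.
    by exfalso; apply: (neg (a - b) (d - b) (d - a)); [lra..|ring].
  by right; left.
by exfalso; apply: (neg (a - b) (b - d) (a - d)); [lra..|ring].
Qed.

Lemma ccw_circle_pt c s a b d : c ^+ 2 + s ^+ 2 = 1 ->
  ccw (circle_pt c s a) (circle_pt c s b) (circle_pt c s d) <-> cyc a b d.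
Proof.
move=> cs; rewrite cyc_prod.
have a0 : 0 < 1 + a ^+ 2 by nra.
have b0 : 0 < 1 + b ^+ 2 by nra.
have d0 : 0 < 1 + d ^+ 2 by nra.
have a1 := lt0r_neq0 a0; have b1 := lt0r_neq0 b0; have d1 := lt0r_neq0 d0.
rewrite /ccw /=.
set e := (X in 0 < X).
have -> : e = 4 * (c ^+ 2 + s ^+ 2) / ((1 + a ^+ 2) * (1 + b ^+ 2) * (1 + d ^+ 2))
    * ((b - a) * (d - b) * (d - a)).
  by rewrite /e; field; rewrite a1 b1 d1.
by rewrite cs pmulr_rgt0 // divr_gt0 ?mulr_gt0.
Qed.

Lemma circle_pt_unit c s t : c ^+ 2 + s ^+ 2 = 1 ->
  (circle_pt c s t).1 ^+ 2 + (circle_pt c s t).2 ^+ 2 = 1.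
Proof.
move=> cs /=; have t0 : 1 + t ^+ 2 != 0 by rewrite gt_eqF //; nra.
by transitivity (c ^+ 2 + s ^+ 2) => //; field.
Qed.

Lemma ccw_irr1 (p q : R * R) : ~ ccw p p q.
Proof. by rewrite /ccw !subrr !mul0r subrr ltxx. Qed.

Lemma ccw_irr2 (p q : R * R) : ~ ccw p q q.
Proof. by rewrite /ccw mulrC subrr ltxx. Qed.

Lemma circle_pt_inj c s : c ^+ 2 + s ^+ 2 = 1 -> injective (circle_pt c s).
Proof.
move=> cs a b E; apply/eqP; rewrite eq_le; apply/andP; split;
  rewrite leNgt; apply/negP => /(ccw_base _ _ cs); rewrite E; exact: ccw_irr2.
Qed.

Lemma circle_pt_neq c s t : c ^+ 2 + s ^+ 2 = 1 -> circle_pt c s t <> (c, s).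
Proof.
move=> cs E; have : t < t + 1 by rewrite ltrDl.
by move=> /(ccw_base _ _ cs); rewrite E; exact: ccw_irr1.
Qed.

End cyclic_order.

Section circle.
Local Open Scope ring_scope.
Variables (R : realType) (S : surfaceGroup).
Variable (C : boundary S -> boundary S -> boundary S -> Prop).
Hypothesis HC : boundary_orientation R C.
Local Notation B := (boundary S).
Implicit Types (x y z a b o : B).

(* The circle cut at o, as the half-line [0, +oo[ *)
Record coordinate o (T : B -> R) : Prop := Coordinate {
  coord_inj : injective T;
  coord_base : T o = 0;
  coord_pos : forall z, z <> o -> 0 < T z;
  coord_surj : forall s, 0 < s -> exists z, T z = s;
  coord_cyc : forall a b c, C a b c <-> cyc (T a) (T b) (T c) }.

(** Away from [o], [T] is the exponential of the stereographic parameter; the exponential makes room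
    for [o] at 0, below all other points. Statements on the cyclic order thereby become linear
    inequalities. *)
Lemma ex_coordinate o : exists T, coordinate o T.
Proof.
have [[phi [phi_inj phi_range _ phiC]] _] := HC.
have unit z : (phi z).1 ^+ 2 + (phi z).2 ^+ 2 = 1.
  have : range phi (phi z) by exists z.
  by rewrite phi_range.
set c := (phi o).1; set s := (phi o).2.
have cs : c ^+ 2 + s ^+ 2 = 1 by exact: unit.
have phio : phi o = (c, s) by rewrite /c /s; case: (phi o).
pose t z := (s * (phi z).1 - c * (phi z).2) / (1 - (c * (phi z).1 + s * (phi z).2)).
have phit z : z <> o -> phi z = circle_pt c s (t z).
  move=> zo; rewrite [LHS]surjective_pairing; apply: circle_ptP => //.
  by rewrite -surjective_pairing -phio => /phi_inj.
pose T z := if z == o then 0 else expR (t z).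
have To : T o = 0 by rewrite /T eqxx.
have Tpos z : z <> o -> 0 < T z by rewrite /T => /eqP/negPf ->; exact: expR_gt0.
have TE z : z <> o -> T z = expR (t z) by rewrite /T => /eqP/negPf ->.
exists T; split => //.
- move=> a b; have [->|/eqP ao] := eqVneq a o; have [->|/eqP bo] := eqVneq b o => //.
  + by move=> E; have := Tpos b bo; rewrite -E To ltxx.
  + by move=> E; have := Tpos a ao; rewrite E To ltxx.
  rewrite !TE // => /expR_inj E; apply: phi_inj; by rewrite !phit // E.
- move=> r r0.
  have : unit_circle (circle_pt c s (ln r)) by exact: circle_pt_unit.
  rewrite -phi_range => -[z _ zE]; exists z.
  have zo : z <> o by move=> zo; move: zE; rewrite zo phio => /esym; exact: circle_pt_neq.
  rewrite TE // -[RHS](@lnK _ r) //; congr expR.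
  by apply: (circle_pt_inj cs); rewrite -phit.
have baseE a b : a <> o -> b <> o -> ccw (phi o) (phi a) (phi b) <-> T a < T b.
  by move=> ao bo; rewrite phio !phit // ccw_base // !TE // ltr_expR.
have rot (p q r : R * R) : ccw p q r = ccw q r p.
  by apply: (congr1 (fun e : R => is_true (0 < e))); ring.
move=> a b d; rewrite phiC {phi_range}.
have [->|/eqP ao] := eqVneq a o; have [->|/eqP bo] := eqVneq b o;
  have [->|/eqP co] := eqVneq d o.
- by split=> [/ccw_irr1//|]; rewrite /cyc => H; exfalso; lra.
- by split=> [/ccw_irr1//|]; rewrite /cyc => H; exfalso; have := Tpos d co; lra.
- split=> [|]; first by rewrite rot rot => /ccw_irr1.
  by rewrite /cyc => H; exfalso; have := Tpos b bo; lra.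
- by rewrite baseE // /cyc To; have := Tpos b bo; have := Tpos d co; lra.
- by split=> [/ccw_irr2//|]; rewrite /cyc => H; exfalso; have := Tpos a ao; lra.
- by rewrite rot baseE // /cyc To; have := Tpos a ao; have := Tpos d co; lra.
- by rewrite rot rot baseE // /cyc To; have := Tpos a ao; have := Tpos b bo; lra.
by rewrite !phit // ccw_circle_pt // /cyc !TE // !ltr_expR.
Qed.

End circle.

(** * Fixed points and generic points *)

Section circle_topology.
Local Open Scope ring_scope.
Variables (R : realType) (S : surfaceGroup).
Variable (C : boundary S -> boundary S -> boundary S -> Prop).
Hypothesis HC : boundary_orientation R C.
Local Notation B := (boundary S).
Implicit Types (x y z a b o : B).

Lemma open_orientation (X : topologicalType) (f g h : X -> B) :
  continuous f -> continuous g -> continuous h ->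
  open [set p | C (f p) (g p) (h p)].
Proof.
move=> cf cg ch; have [[phi [_ _ phi_open phiC]] _] := HC.
have cphi : continuous phi by apply/continuousP => V oV; apply/phi_open; exists V.
have c1 (k : X -> B) : continuous k -> continuous (fun p => (phi (k p)).1).
  move=> ck p; apply: (@continuous_comp _ _ _ (phi \o k) fst).
    by apply: continuous_comp; [exact: ck|exact: cphi].
  exact: cvg_fst.
have c2 (k : X -> B) : continuous k -> continuous (fun p => (phi (k p)).2).
  move=> ck p; apply: (@continuous_comp _ _ _ (phi \o k) snd).
    by apply: continuous_comp; [exact: ck|exact: cphi].
  exact: cvg_snd.
pose e p := ((phi (g p)).1 - (phi (f p)).1) * ((phi (h p)).2 - (phi (f p)).2) -
  ((phi (g p)).2 - (phi (f p)).2) * ((phi (h p)).1 - (phi (f p)).1).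
have -> : [set p | C (f p) (g p) (h p)] = e @^-1` [set t | 0 < t].
  by apply/seteqP; split=> p /= /phiC.
apply: open_comp => [p _|]; last exact: open_gt.
move: p; change (continuous e); rewrite /e.
move=> p; apply: cvgB; apply: cvgM; apply: cvgB;
  solve [exact: c1|exact: c2].
Qed.

(** Two points differ exactly when the open arc from one to the other contains a third, so the set
    is a union of sets that are open by [open_orientation]. This plays the role of Hausdorffness of
    the boundary. *)
Lemma open_neq_boundary (X : topologicalType) (f g : X -> B) :
  continuous f -> continuous g -> open [set p | f p <> g p].
Proof.
move=> cf cg.
rewrite (_ : [set p | _] = \bigcup_c ([set p | C (f p) c (g p)])).
  apply: bigcup_open => c _; apply: open_orientation => // p; exact: cst_continuous.
apply/seteqP; split=> p /=.
  move=> fg; have [T HT] := ex_coordinate HC (f p).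
  have gp0 : 0 < T (g p) by apply: (coord_pos HT) => E; apply: fg.
  have [|c Tc] := @coord_surj _ _ _ _ _ HT (T (g p) / 2); first by rewrite divr_gt0.
  by exists c => //; apply/(coord_cyc HT); rewrite (coord_base HT) Tc /cyc; lra.
move=> [c _ H] E; have [T HT] := ex_coordinate HC (f p).
by move/(coord_cyc HT): H; rewrite E /cyc; lra.
Qed.

Lemma fixed_pair_fixed (g : S) q p z : fixed_pair g q p -> act g z = z ->
  z = q \/ z = p.
Proof.
move=> [_ _ _ Hp _] gz; apply: contrapT => /not_orP[zq zp].
have op : open [set w : B | w <> z].
  by apply: open_neq_boundary => w; [exact: cvg_id|exact: cst_continuous].
have := Hp z zq [set w : B | w <> z] (open_nbhs_nbhs (conj op (nesym zp))).
by move=> [n _ /(_ n (leqnn n))] /=; rewrite act_expg_fix.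
Qed.

(** Some power [g ^+ j] commutes with [h], hence fixes [h p]. As [h p] is not [q], its orbit under
    [g] tends to [p], but along multiples of [j] it is constant; so [h p = p], and [p] is one of the
    two fixed points of [h]. *)
Lemma fixed_pair_inj (g h : S) q p p' : gromov_hyperbolic S ->
  fixed_pair g q p -> fixed_pair h q p' -> p = p'.
Proof.
move=> hyp Hg Hh.
have [qp gq gp Hgp _] := Hg; have [qp' hq hp' _ _] := Hh.
have [j j0 comm] := commuting_power hyp gq hq.
have gjhp : act (g ^+ j)%g (act h p) = act h p.
  by rewrite -actM comm actM (act_expg_fix j gp).
have hpq : act h p <> q by rewrite -{1}hq => /act_inj/esym.
have hpp : act h p = p.
  apply: contrapT => hpp.
  have op : open [set w : B | w <> act h p].
    by apply: open_neq_boundary => w; [exact: cvg_id|exact: cst_continuous].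
  have := Hgp _ hpq [set w : B | w <> act h p] (open_nbhs_nbhs (conj op (nesym hpp))).
  move=> [n _ /(_ (j * n)%N)] /=; rewrite leq_pmull // => /(_ isT); apply.
  rewrite expgnA; elim: n => [|n IH]; first by rewrite expg0 act1.
  by rewrite expgS actM IH.
by have [pq|] := fixed_pair_fixed Hh hpp; first by case: qp.
Qed.

(** Horizontal and vertical lines through a generic point lie entirely in [Gcirc]. *)
Definition generic z : Prop :=
  forall (g : S) q p, g <> 1%g -> fixed_pair g q p -> z <> q /\ z <> p.

Lemma countable_nongeneric : countable (~` generic).
Proof.
pose F (g : S) := [set z : B | exists q p, fixed_pair g q p /\ (z = q \/ z = p)].
have cS : countable [set: S].
  rewrite (_ : setT = \bigcup_n [set x : S | (wlen x <= n)%N]).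
    by apply: bigcup_countable => // n _; apply: finite_set_countable; exact: finite_ball.
  by apply/seteqP; split => // x _; exists (wlen x) => /=.
apply: (@sub_countable _ _ _ (\bigcup_g F g)).
  apply: subset_card_le => z /existsNP[g /existsNP[q /existsNP[p]]].
  move=> /not_implyP[_ /not_implyP[H /not_andP zqp]]; exists g => //; exists q, p.
  by split => //; case: zqp => /contrapT; [left|right].
apply: bigcup_countable => // g _; apply: finite_set_countable.
have [[q [p H]]|H] := pselect (exists q p, fixed_pair g q p); last first.
  apply: (@sub_finite_set _ _ set0) => // z [q [p [H' _]]]; apply: H; by exists q, p.
apply: (@sub_finite_set _ _ [set q; p]); last exact: finite_set2.
by move=> z [q' [p' [[_ gq gp _ _] [->|->]]]] /=; apply: (fixed_pair_fixed H).
Qed.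

(** An interval without generic points would be the image of a countable set, although its Lebesgue
    measure is positive. *)
Lemma generic_dense (o : B) (T : B -> R) : coordinate C o T ->
  forall s t, 0 <= s -> s < t -> exists2 z, generic z & s < T z < t.
Proof.
move=> HT s t s0 st; apply: contrapT => H.
have cnt : countable `]s, t[%classic.
  apply: (@sub_countable _ _ _ (T @` (~` generic))).
    apply: subset_card_le => u /=; rewrite in_itv /= => sut.
    have [|z Tz] := @coord_surj _ _ _ _ _ HT u; first by case/andP: sut => /(le_lt_trans s0).
    by exists z => // gz; apply: H; exists z => //; rewrite Tz.
  exact: sub_countable (card_image_le _ _) countable_nongeneric.
have := countable_lebesgue_measure0 cnt.
rewrite lebesgue_measure_itv /= lte_fin st -EFinD => -[] /eqP.
by rewrite subr_eq0 gt_eqF.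
Qed.

Lemma generic_sequence (x : B) : exists y : nat -> B,
  [/\ forall j, generic (y j), forall j, y j <> x,
      forall i j, (i < j)%N -> C x (y j) (y i) &
      forall b, b <> x -> exists j, forall i, (j <= i)%N -> C x (y i) b].
Proof.
have [T HT] := ex_coordinate HC x.
(* The intervals for different [j] are disjoint, so any choice of points is strictly decreasing and
   tends to [x] from the right. *)
have H j : exists z, generic z /\ j.+2%:R^-1 < T z < j.+1%:R^-1.
  have [||z gz Hz] := @generic_dense _ _ HT j.+2%:R^-1 j.+1%:R^-1.
  - by rewrite invr_ge0.
  - by rewrite ltf_pV2 ?posrE // ltr_nat.
  by exists z.
have [y Hy] := choice H.
have y0 j : 0 < T (y j).
  by have [_ /andP[/(le_lt_trans _) + _]] := Hy j; apply; rewrite invr_ge0.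
have mono i j : (i < j)%N -> T (y j) < T (y i).
  move=> ij; have [_ /andP[_ h1]] := Hy j; have [_ /andP[h2 _]] := Hy i.
  apply: lt_le_trans h1 _; apply: le_trans (ltW h2).
  by rewrite lef_pV2 ?posrE // ler_nat.
exists y; split.
- by move=> j; have [] := Hy j.
- by move=> j yx; have := y0 j; rewrite yx (coord_base HT) ltxx.
- move=> i j /mono ij; apply/(coord_cyc HT); rewrite (coord_base HT) /cyc.
  by have := y0 j; lra.
move=> b /(coord_pos HT) Tb.
exists (Num.trunc (T b)^-1) => i ji; apply/(coord_cyc HT).
rewrite (coord_base HT) /cyc; left; split => //.
have [_ /andP[_ /lt_trans]] := Hy i; apply.
rewrite -[ltRHS]invrK ltf_pV2 ?posrE ?invr_gt0 //.
by apply: lt_le_trans (Num.Theory.truncnS_gt _) _; rewrite ler_nat.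
Qed.

End circle_topology.

(** * The sets G_le and G_ge *)

Section intervals.
Local Open Scope ring_scope.
Variables (R : realType) (S : surfaceGroup).
Variable (C : boundary S -> boundary S -> boundary S -> Prop).
Hypothesis HC : boundary_orientation R C.
Local Notation B := (boundary S).
Implicit Types (x y z a b o : B).

Lemma orientation_act (g : S) x y z : C (act g x) (act g y) (act g z) <-> C x y z.
Proof.
have [_ Cact] := HC; split; last exact: Cact.
by move=> /(Cact g^-1%g); rewrite !actK.
Qed.

Lemma orientation_neq x y z : C x y z -> x <> y /\ y <> z.
Proof.
have [T HT] := ex_coordinate HC x.
by move=> /(coord_cyc HT) H; split=> E; exfalso; move: H; rewrite E /cyc; lra.
Qed.

Lemma orientation_rot x y z : C x y z -> C y z x.
Proof.
have [T HT] := ex_coordinate HC x.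
by move=> /(coord_cyc HT) H; apply/(coord_cyc HT); rewrite /cyc in H *; lra.
Qed.

Section coordinates.
Variables (o : B) (T : B -> R).
Hypothesis HT : coordinate C o T.

Lemma coord_eq a b : a = b <-> T a = T b.
Proof. by split=> [->//|/(coord_inj HT)]. Qed.

Lemma coord_neq a b : a <> b <-> T a < T b \/ T b < T a.
Proof.
rewrite coord_eq; split=> [/eqP|]; last by lra.
by rewrite neq_lt => /orP.
Qed.

Lemma coord_cle x a b : cle C x a b <->
  T a = T x \/ T a = T b \/ cyc (T x) (T a) (T b).
Proof.
rewrite -(coord_cyc HT) -!coord_eq; split=> [[]|[|[]]] H;
  by [left|right; left|right; right|constructor 1|constructor 2|constructor 3].
Qed.

Lemma coord_G_le x y a b : G_le C (x, y) (a, b) <->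
  [/\ T a = T x \/ T a = T b \/ cyc (T x) (T a) (T b),
      T a < T b \/ T b < T a &
      T b = T x \/ T b = T y \/ cyc (T x) (T b) (T y)].
Proof. by split=> -[/coord_cle ? /coord_neq ? /coord_cle ?]. Qed.

Lemma coord_G_ge x y a b : G_ge C (x, y) (a, b) <->
  [/\ T a < T b \/ T b < T a,
      T x = T a \/ T x = T y \/ cyc (T a) (T x) (T y),
      T x < T y \/ T y < T x &
      T y = T a \/ T y = T b \/ cyc (T a) (T y) (T b)].
Proof.
split=> [[/coord_neq ? /coord_G_le[]]//|[? ? ? ?]].
by split; [exact/coord_neq|exact/coord_G_le].
Qed.

Lemma coord_ge0 z : 0 <= T z.
Proof.
have [->|/eqP zo] := eqVneq z o; first by rewrite (coord_base HT).
exact/ltW/(coord_pos HT).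
Qed.

(** The strip consists of the (a, b) with [a] in ]o, x] and [b] in [y, a[; it shrinks when [x] moves
    down towards [o] and [y] moves up. *)
Lemma G_ge_strip x xn y yn : 0 < T xn -> T xn <= T x -> T x < T y -> T y <= T yn ->
  G_ge C (xn, yn) `\` G_ge C (o, yn) `<=` G_ge C (x, y) `\` G_ge C (o, y).
Proof.
move=> h1 h2 h3 h4 [a b] [/coord_G_ge[ab p1 p2 p3] p4].
have a0 := coord_ge0 a; have b0 := coord_ge0 b; have To := coord_base HT.
have {}p4 : T o < T a /\ T a <= T xn.
  apply: contrapT => ao; apply: p4; apply/coord_G_ge.
  by rewrite /cyc in p1 p3 *; split; lra.
split; first by apply/coord_G_ge; rewrite /cyc in p1 p3 *; split; lra.
by move=> /coord_G_ge; rewrite /cyc in p1 p3 * => -[q1 q2 q3 q4]; lra.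
Qed.

(** Here [x, y] passes through [o], and the strip consists of its subarcs [a, b] that start in [x,
    o[; it shrinks when both ends move towards [o]. *)
Lemma G_le_strip x xn y yn : 0 < T yn -> T yn <= T y -> T y < T x -> T x <= T xn ->
  G_le C (xn, yn) `\` G_le C (o, yn) `<=` G_le C (x, y) `\` G_le C (o, y).
Proof.
move=> h1 h2 h3 h4 [a b] [/coord_G_le[p1 p2 p3] p4].
have a0 := coord_ge0 a; have b0 := coord_ge0 b; have To := coord_base HT.
have {}p4 : T xn <= T a.
  apply: contrapT => ao; apply: p4; apply/coord_G_le.
  by rewrite /cyc in p1 p3 *; split; lra.
split; first by apply/coord_G_le; rewrite /cyc in p1 p3 *; split; lra.
by move=> /coord_G_le; rewrite /cyc in p1 p3 * => -[q1 q2 q3]; lra.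
Qed.

End coordinates.

End intervals.

(** * Monotonicity, limits and measurability of [G_le] and [G_ge] *)

Section interval_measurability.
Local Open Scope ring_scope.
Variables (R : realType) (S : surfaceGroup).
Variable (C : boundary S -> boundary S -> boundary S -> Prop).
Hypothesis HC : boundary_orientation R C.
Local Notation B := (boundary S).
Implicit Types (x y z a b o : B).

Lemma G_ge_sub x x' y : C x x' y -> G_ge C (x, y) `<=` G_ge C (x', y).
Proof.
have [T HT] := ex_coordinate HC x; have To := coord_base HT.
move=> /(coord_cyc HT) H [a b] /(coord_G_ge HT)[p1 p2 p3 p4]; apply/(coord_G_ge HT).
have a0 := coord_ge0 HT a; have b0 := coord_ge0 HT b.
by rewrite /cyc in H p2 p4 *; split; lra.
Qed.

Lemma G_le_sub x x' y : C x x' y -> G_le C (x', y) `<=` G_le C (x, y).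
Proof.
have [T HT] := ex_coordinate HC x; have To := coord_base HT.
move=> /(coord_cyc HT) H [a b] /(coord_G_le HT)[p1 p2 p3]; apply/(coord_G_le HT).
have a0 := coord_ge0 HT a; have b0 := coord_ge0 HT b.
by rewrite /cyc in H p1 p3 *; split; lra.
Qed.

Lemma G_le_subr x y y' : C x y y' -> G_le C (x, y) `<=` G_le C (x, y').
Proof.
have [T HT] := ex_coordinate HC x; have To := coord_base HT.
move=> /(coord_cyc HT) H [a b] /(coord_G_le HT)[p1 p2 p3]; apply/(coord_G_le HT).
have a0 := coord_ge0 HT a; have b0 := coord_ge0 HT b.
by rewrite /cyc in H p1 p3 *; split; lra.
Qed.

(** A nondegenerate subarc [a, b] of [x, y j] has [b] different from [x], and [y j] eventually
    passes below [b]. With [bigcap_G_ge] this feeds continuity from above in the limits from the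
    right. *)
Lemma bigcap_G_le x (y : nat -> B) :
  (forall b, b <> x -> exists j, C x (y j) b) ->
  \bigcap_j G_le C (x, y j) = set0.
Proof.
move=> lim; have [T HT] := ex_coordinate HC x; have To := coord_base HT.
apply/seteqP; split => // -[a b] H.
have [bx|/eqP/lim[j /(coord_cyc HT) Hj]] := eqVneq b x.
  have /(coord_G_le HT)[] := H 0%N I.
  have a0 := coord_ge0 HT a; rewrite bx /cyc; lra.
have /(coord_G_le HT)[] := H j I.
have a0 := coord_ge0 HT a; have b0 := coord_ge0 HT b.
by rewrite /cyc in Hj *; lra.
Qed.

Lemma bigcap_G_ge x y (x' : nat -> B) : (forall j, C x (x' j) y) ->
  (forall b, b <> x -> exists j, C x (x' j) b) ->
  \bigcap_j G_ge C (x' j, y) = G_ge C (x, y).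
Proof.
move=> xy lim; have [T HT] := ex_coordinate HC x; have To := coord_base HT.
apply/seteqP; split => [[a b] H|p Hp j _]; last exact: G_ge_sub (xy j) _ Hp.
have a0 := coord_ge0 HT a; have b0 := coord_ge0 HT b.
apply/(coord_G_ge HT).
have [ax|/eqP/lim[j /(coord_cyc HT) Hj]] := eqVneq a x.
  have /(coord_G_ge HT) := H 0%N I; rewrite ax /cyc => -[p1 p2 p3 p4].
  by have /(coord_cyc HT) := xy 0%N; rewrite /cyc; split; lra.
have /(coord_G_ge HT)[] := H j I.
have /(coord_cyc HT) := xy j.
by rewrite /cyc in Hj * => p1 p2 p3 p4; split; lra.
Qed.

Local Notation borel := (borel_pairs S).

Lemma measurable_open (U : set borel) : open (U : set (B * B)) -> measurable U.
Proof. by move=> oU; apply: sub_sigma_algebra. Qed.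

Lemma continuous_fst_boundary : continuous (fst : B * B -> B).
Proof. by move=> p; exact: cvg_fst. Qed.

Lemma continuous_snd_boundary : continuous (snd : B * B -> B).
Proof. by move=> p; exact: cvg_snd. Qed.

Lemma measurable_neq (f g : B * B -> B) : continuous f -> continuous g ->
  measurable ([set p | f p <> g p] : set borel).
Proof. by move=> cf cg; apply: measurable_open; apply: (open_neq_boundary HC). Qed.

Lemma measurable_eq (f g : B * B -> B) : continuous f -> continuous g ->
  measurable ([set p | f p = g p] : set borel).
Proof.
move=> cf cg; rewrite -[X in measurable X]setCK; apply: measurableC.
rewrite (_ : ~` _ = [set p | f p <> g p]); last by apply/seteqP; split.
exact: measurable_neq.
Qed.

Lemma measurable_cle (f g h : B * B -> B) :
  continuous f -> continuous g -> continuous h ->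
  measurable ([set p | cle C (f p) (g p) (h p)] : set borel).
Proof.
move=> cf cg ch.
rewrite (_ : [set p | _] = [set p | g p = f p] `|` [set p | g p = h p] `|`
    [set p | C (f p) (g p) (h p)]); last first.
  apply/seteqP; split=> p /=; first by case; [left; left|left; right|right].
  by case=> [[]|]; [constructor 1|constructor 2|constructor 3].
apply: measurableU; first by apply: measurableU; exact: measurable_eq.
by apply: measurable_open; apply: (open_orientation HC).
Qed.

Lemma measurable_G_le (p : B * B) : measurable (G_le C p : set borel).
Proof.
have c1 := continuous_fst_boundary; have c2 := continuous_snd_boundary.
have cc b : continuous ((fun=> b) : B * B -> B) by move=> ?; exact: cvg_cst.
rewrite (_ : G_le C p = [set q | cle C p.1 q.1 q.2] `&` [set q | q.1 <> q.2]
  `&` [set q | cle C p.1 q.2 p.2]).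
  apply: measurableI; first apply: measurableI.
  - exact: (measurable_cle (cc p.1) c1 c2).
  - exact: measurable_neq.
  - exact: (measurable_cle (cc p.1) c2 (cc p.2)).
by apply/seteqP; split=> q [] //= [].
Qed.

Lemma measurable_G_ge (p : B * B) : measurable (G_ge C p : set borel).
Proof.
have c1 := continuous_fst_boundary; have c2 := continuous_snd_boundary.
have cc b : continuous ((fun=> b) : B * B -> B) by move=> ?; exact: cvg_cst.
rewrite (_ : G_ge C p = [set q | q.1 <> q.2] `&` ([set q | cle C q.1 p.1 p.2] `&`
  ([set q | p.1 <> p.2] `&` [set q | cle C q.1 p.2 q.2]))).
  apply: measurableI; first exact: measurable_neq.
  apply: measurableI; first exact: (measurable_cle c1 (cc p.1) (cc p.2)).
  apply: measurableI; first exact: (measurable_neq (cc p.1) (cc p.2)).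
  exact: (measurable_cle c1 (cc p.2) c2).
by apply/seteqP; split=> q [? []] //= ? [].
Qed.

End interval_measurability.

(** * Comparison of finite masses and continuity from above *)

Section measure_differences.
Local Open Scope ring_scope.
Variables (R : realType) (d : measure_display) (X : measurableType d).
Variable (nu : {measure set X -> \bar R}).
Implicit Types A : set X.

Lemma fine_measure_le A A' : measurable A -> measurable A' ->
  nu A' \is a fin_num -> A `<=` A' -> fine (nu A) <= fine (nu A').
Proof.
move=> mA mA' finA' sub; have le : (nu A <= nu A')%E by apply: le_measure; rewrite ?inE.
apply: fine_le => //; apply/fin_numPlt; rewrite (lt_le_trans _ (measure_ge0 _ _)) ?ltNyr //=.
by apply: le_lt_trans le _; rewrite ltey_eq finA'.
Qed.

(** Both differences are masses of set differences; in the application these are the strips. *)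
Lemma fine_measure_diff_le A1 A2 A1' A2' :
  measurable A1 -> measurable A2 -> measurable A1' -> measurable A2' ->
  nu A2 \is a fin_num -> nu A2' \is a fin_num -> A1 `<=` A2 -> A1' `<=` A2' ->
  A2 `\` A1 `<=` A2' `\` A1' ->
  fine (nu A2) - fine (nu A1) <= fine (nu A2') - fine (nu A1').
Proof.
move=> m1 m2 m1' m2' fin2 fin2' s s' ss.
have H A A' : measurable A -> measurable A' -> nu A' \is a fin_num -> A `<=` A' ->
    nu (A' `\` A) \is a fin_num /\ fine (nu (A' `\` A)) = fine (nu A') - fine (nu A).
  move=> mA mA' finA' sub.
  have finA : nu A \is a fin_num.
    rewrite ge0_fin_numE //; apply: le_lt_trans (_ : nu A' < +oo)%E.
      by apply: le_measure; rewrite ?inE.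
    by rewrite ltey_eq finA'.
  rewrite measureD // ?ltey_eq ?finA' // setIidr // fin_numB finA finA'.
  by rewrite fineB.
have [f1 <-] := H _ _ m1 m2 fin2 s; have [f2 <-] := H _ _ m1' m2' fin2' s'.
by apply: fine_measure_le => //; exact: measurableD.
Qed.

Lemma measure_bigcap_lt (F : nat -> set X) A (e : R) :
  (forall i, measurable (F i)) -> measurable A -> nu (F 0%N) \is a fin_num ->
  (forall i j, (i < j)%N -> F j `<=` F i) -> \bigcap_i F i = A -> 0 < e ->
  exists j, fine (nu (F j)) < fine (nu A) + e.
Proof.
move=> mF mA fin0 dec FA e0.
have decle i j : (i <= j)%N -> F j `<=` F i.
  by rewrite leq_eqVlt => /orP[/eqP ->|/dec].
have finF j : nu (F j) \is a fin_num.
  rewrite ge0_fin_numE //; apply: le_lt_trans (_ : nu (F 0%N) < +oo)%E.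
    by apply: le_measure; rewrite ?inE //; exact: decle.
  by rewrite ltey_eq fin0.
have finA : nu A \is a fin_num.
  rewrite ge0_fin_numE //; apply: le_lt_trans (_ : nu (F 0%N) < +oo)%E.
    by apply: le_measure; rewrite ?inE // -FA; exact: bigcap_inf.
  by rewrite ltey_eq fin0.
have cv : (nu \o F) x @[x --> \oo] --> nu A.
  rewrite -FA; apply: nonincreasing_cvg_mu => //.
  - by rewrite ltey_eq fin0.
  - by rewrite FA.
  - by move=> i j ij; apply/subsetPset; exact: decle.
rewrite -(fineK finA) in cv.
have cv' : forall eps : R, 0 < eps ->
    \forall t \near \oo, `|fine (nu A) - (fine \o (nu \o F)) t| < eps.
  by apply/cvgrPdist_lt; exact: fine_cvg cv.
have [n _ /(_ n (leqnn n)) /=] := cv' _ e0.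
by move=> H; exists n; move: H; rewrite distrC ltr_norml; lra.
Qed.

End measure_differences.

(** * Flat sections and their displacement *)

Section bundle.
Local Open Scope ring_scope.
Variables (R : realType) (S : surfaceGroup).
Variable (C : boundary S -> boundary S -> boundary S -> Prop).
Hypothesis HC : boundary_orientation R C.
Variable P : taxiBundle C R.
Local Notation B := (boundary S).
Local Notation BB := (pairs S).
Implicit Types (x y z a b o : B) (p q : BB) (k g h : S) (s v u : BB -> P) (e : P).

Lemma act2KV k : cancel (act2 k^-1%g) (act2 k).
Proof. by case=> x y; rewrite /act2 /= !actKV. Qed.

(* By equivariance of the projection, so that continuity of the action on the
   boundary is not needed. *)
Lemma Gcirc_act k p : Gcirc p -> Gcirc (act2 k p).
Proof. by move=> /(proj_surj P)[e <-]; rewrite -(proj_act k e); exact: proj_circ. Qed.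

Lemma fshift_inj e : injective (fshift e).
Proof.
move=> c d E; apply/eqP; rewrite -subr_eq0; apply/eqP.
by apply: (@shift_free _ _ _ P e); rewrite -shiftD E shiftD subrr Defs.shift0.
Qed.

Lemma sub_fiberE e c : sub_fiber (fshift e c) e = c.
Proof. by apply: xget_unique => // d /= /fshift_inj. Qed.

Lemma sub_fiberK e e' : bproj e' = bproj e -> e' = fshift e (sub_fiber e' e).
Proof. by move=> /esym/shift_trans[c ->]; rewrite sub_fiberE. Qed.

Lemma act_sectionM g h s p :
  act_section (g * h)%g s p = act_section g (act_section h s) p.
Proof. by rewrite /act_section lift_actM invgM /act2 /= !actM. Qed.

Lemma is_section_act k s : is_section (@Gcirc S) s -> is_section (@Gcirc S) (act_section k s).
Proof. by move=> sec p Gp; rewrite proj_act sec ?act2KV //; exact: Gcirc_act. Qed.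

Lemma carc_act k y y' z : carc C (act k y) (act k y') (act k z) <-> carc C y y' z.
Proof.
split=> -[].
- by move=> /act_inj ->; constructor 1.
- by move=> /act_inj ->; constructor 2.
- by move=> /(orientation_act HC) H; constructor 3.
- by move=> ->; constructor 1.
- by move=> ->; constructor 2.
- by move=> H; constructor 3; apply/(orientation_act HC).
Qed.

Lemma vsegment_act k p q A : vsegment C p q A ->
  vsegment C (act2 k p) (act2 k q) (act2 k @` A).
Proof.
case=> x y y' yx y'x H.
rewrite (_ : _ @` _ = [set act k x] `*` carc C (act k y) (act k y')).
  constructor; [by move=> /act_inj|by move=> /act_inj|].
  by case: H => [->|H]; [left|right; apply/(orientation_act HC)].
apply/seteqP; split=> [_ [[a b] [/= -> H2] <-]|[a b] [/= -> H2]].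
  by split => //=; apply/carc_act.
exists (x, act k^-1%g b); last by rewrite /act2 /= actKV.
by split => //=; apply/(carc_act k); rewrite actKV.
Qed.

Lemma hsegment_act k p q A : hsegment C p q A ->
  hsegment C (act2 k p) (act2 k q) (act2 k @` A).
Proof.
case=> x x' y xy x'y H.
rewrite (_ : _ @` _ = carc C (act k x) (act k x') `*` [set act k y]).
  constructor; [by move=> /act_inj|by move=> /act_inj|].
  by case: H => [->|H]; [left|right; apply/(orientation_act HC)].
apply/seteqP; split=> [_ [[a b] [/= H1 ->] <-]|[a b] [/= H1 ->]].
  by split => //=; apply/carc_act.
exists (act k^-1%g a, y); last by rewrite /act2 /= actKV.
by split => //=; apply/(carc_act k); rewrite actKV.
Qed.

Lemma flat_act_section k A s :
  is_segment P (act2 k^-1%g @` A) -> flat (act2 k^-1%g @` A) s -> flat A (act_section k s).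
Proof.
move=> segA flA; have := flat_act k segA flA; rewrite image_comp.
by rewrite (_ : _ @` A = A) // -[RHS]image_id; apply: eq_imagel => p _ /=; rewrite act2KV.
Qed.

Lemma segment_sub_act k A : A `<=` @Gcirc S -> act2 k @` A `<=` @Gcirc S.
Proof. by move=> sub _ [p /sub Gp <-]; exact: Gcirc_act. Qed.

Lemma vertical_flat_act k v : vertical_flat v -> vertical_flat (act_section k v).
Proof.
move=> [sec fl]; split; first exact: is_section_act.
move=> p q A vA sub; have vA' := vsegment_act k^-1%g vA.
have sub' := segment_sub_act (k := k^-1%g) sub.
apply: flat_act_section; last exact: fl vA' sub'.
by split => //; exists (act2 k^-1%g p), (act2 k^-1%g q); right.
Qed.

Lemma horizontal_flat_act k u : horizontal_flat u -> horizontal_flat (act_section k u).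
Proof.
move=> [sec fl]; split; first exact: is_section_act.
move=> p q A hA sub; have hA' := hsegment_act k^-1%g hA.
have sub' := segment_sub_act (k := k^-1%g) sub.
apply: flat_act_section; last exact: fl hA' sub'.
by split => //; exists (act2 k^-1%g p), (act2 k^-1%g q); left.
Qed.

Definition displacement k v p : R := sub_fiber (act_section k v p) (v p).

Lemma act_section_shift k v p : is_section (@Gcirc S) v -> Gcirc p ->
  act_section k v p = fshift (v p) (displacement k v p).
Proof. by move=> sec Gp; apply: sub_fiberK; rewrite (is_section_act k sec) ?sec. Qed.

(** Both [v] and [k.v] are flat over the vertical segment, hence lie in one orbit of sections. *)
Lemma displacement_vertical k v x y y' : vertical_flat v ->
  C x y y' -> (forall z, carc C y y' z -> Gcirc (x, z)) ->
  displacement k v (x, y) = displacement k v (x, y').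
Proof.
move=> vfl xyy' sub.
pose A : set BB := [set x] `*` carc C y y'.
have subA : A `<=` @Gcirc S by move=> [a b] [/= -> /sub].
have neq z : carc C y y' z -> z <> x by move=> /sub[/= + _] E; rewrite E.
have segA : vsegment C (x, y) (x, y') A.
  by constructor; [apply: neq; constructor 1|apply: neq; constructor 2|right].
have [_ /(_ _ _ _ segA subA) fl] := vfl.
have [_ /(_ _ _ _ segA subA) fl'] := vertical_flat_act k vfl.
have isA : is_segment P A by split => //; exists (x, y), (x, y'); right.
have /(flat_orbit _ isA fl)[c Hc] := fl'.
by rewrite /displacement !Hc ?sub_fiberE //; split=> //=; [constructor 2|constructor 1].
Qed.

Lemma displacement_horizontal k v u (m : BB -> R) x x' y :
  vertical_flat v -> horizontal_flat u ->
  (forall p, Gcirc p -> u p = fshift (v p) (m p)) ->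
  C y x x' -> (forall z, carc C x x' z -> Gcirc (z, y)) ->
  displacement k v (x, y) + m (act2 k^-1%g (x, y)) - m (x, y) =
  displacement k v (x', y) + m (act2 k^-1%g (x', y)) - m (x', y).
Proof.
move=> [vsec _] ufl um yxx' sub.
pose A : set BB := carc C x x' `*` [set y].
have subA : A `<=` @Gcirc S by move=> [a b] [/= /sub + ->].
have neq z : carc C x x' z -> z <> y by move=> /sub[/= + _] E; rewrite E.
have segA : hsegment C (x, y) (x', y) A.
  by constructor; [apply: neq; constructor 1|apply: neq; constructor 2|right].
have [_ /(_ _ _ _ segA subA) fl] := ufl.
have [_ /(_ _ _ _ segA subA) fl'] := horizontal_flat_act k ufl.
have isA : is_segment P A by split => //; exists (x, y), (x', y); left.
have /(flat_orbit _ isA fl)[c Hc] := fl'.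
(* The constant [c] is the difference of the horizontally flat sections [k.u] and [u], rewritten
   through [v]. *)
suff H p : A p -> displacement k v p + m (act2 k^-1%g p) - m p = c.
  by rewrite !H //; split=> //=; [constructor 2|constructor 1].
move=> Ap; have Gp := subA _ Ap; have Gp' := Gcirc_act k^-1%g Gp.
have := Hc p Ap; rewrite {1}/act_section um // shift_act.
rewrite -[lift_act k _]/(act_section k v p) act_section_shift // um // !shiftD.
by move=> /fshift_inj; lra.
Qed.

Lemma generic_Gcirc_r y z : generic y -> z <> y -> Gcirc (z, y).
Proof. by move=> gy zy; split => // -[g g1 /(gy _ _ _ g1)[]]. Qed.

Lemma generic_Gcirc_l y z : generic y -> y <> z -> Gcirc (y, z).
Proof. by move=> gy zy; split => // -[g g1 /(gy _ _ _ g1)[]]. Qed.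

Lemma carc_base_neq x y y' z : C x y y' -> carc C y y' z -> z <> x.
Proof.
have [T HT] := ex_coordinate HC x; have To := coord_base HT.
move=> /(coord_cyc HT) H [->|->|/(coord_cyc HT) H'] E;
  move: H; try move: H'; rewrite ?E /cyc; lra.
Qed.

Lemma displacement_generic k v x y y' : vertical_flat v -> generic x ->
  C x y y' -> displacement k v (x, y) = displacement k v (x, y').
Proof.
move=> vfl gx xyy'; apply: displacement_vertical => // z /(carc_base_neq xyy') zx.
exact/generic_Gcirc_l/nesym.
Qed.

(** By [fixed_pair_inj] the vertical line over [x] misses at most one point of [Gcirc] off the
    diagonal, namely the attracting point belonging to [x]. That point serves as [z]; if there is
    none, any other point does. *)
Lemma exists_gap : gromov_hyperbolic S -> forall x, exists z, z <> x /\
  forall y, C x y z -> Gcirc (x, y).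
Proof.
move=> hyp x; have [T HT] := ex_coordinate HC x; have To := coord_base HT.
have [[g [p [g1 Hp]]]|H] := pselect (exists g (p : B), g <> 1%g /\ fixed_pair g x p).
  exists p; split; first by have [/nesym] := Hp.
  move=> y /(orientation_neq HC)[xy yp]; split => //= -[h h1 Hy]; apply: yp.
  exact: (fixed_pair_inj HC hyp Hy Hp).
have [z Tz] := coord_surj HT ltr01; exists z; split.
  by move=> zx; move: Tz; rewrite zx To => /esym/eqP; rewrite oner_eq0.
by move=> y /(orientation_neq HC)[xy _]; split => //= -[h h1 Hy]; apply: H; exists h, y.
Qed.

Lemma right_filter_proper x : ProperFilter (right_filter C x).
Proof.
have [T HT] := ex_coordinate HC x; have To := coord_base HT.
have pos := coord_pos HT.
apply: Build_ProperFilter_ex => [A [z /pos Tz zA]|].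
  have [|y Ty] := @coord_surj _ _ _ _ _ HT (T z / 2); first by rewrite divr_gt0.
  by exists y; apply/zA/(coord_cyc HT); rewrite Ty To /cyc; lra.
split.
- by have [z Tz] := coord_surj HT ltr01; exists z => // E; move: Tz; rewrite E To; lra.
- move=> A A' [z zx zA] [z' z'x zA'].
  have := pos _ zx; have := pos _ z'x.
  case: (leP (T z) (T z')) => [zz|/ltW zz] Tz Tz'; [exists z|exists z'] => // y xy.
    split; first exact: zA.
    apply: zA'; apply/(coord_cyc HT); move/(coord_cyc HT): xy; rewrite To /cyc; lra.
  split; last exact: zA'.
  apply: zA; apply/(coord_cyc HT); move/(coord_cyc HT): xy; rewrite To /cyc; lra.
- by move=> A A' sub [z zx zA]; exists z => // y /zA/sub.
Qed.

(** The displacement is constant on the vertical segments within the gap, so the limit from the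
    right is the limit of an eventually constant function. *)
Lemma f_LP_displacement k (L : triple P) x y z : vertical_flat (tr_v L) ->
  (forall w, C x w z -> Gcirc (x, w)) -> C x y z ->
  f_LP L (act_triple k L) x = displacement k (tr_v L) (x, y).
Proof.
move=> vfl gap xyz; have [T HT] := ex_coordinate HC x; have To := coord_base HT.
have FF := right_filter_proper x.
apply: lim_near_cst; first exact: norm_hausdorff.
exists z => [E|w xwz]; first by move/(coord_cyc HT): xyz; rewrite E To /cyc; lra.
rewrite -[LHS]/(displacement k (tr_v L) (x, w)).
move/(coord_cyc HT): (xyz); move/(coord_cyc HT): (xwz); rewrite To /cyc => H H'.
have z0 := coord_ge0 HT z.
have between c d t : 0 < T c -> T d < T z -> carc C c d t -> T c < T d -> Gcirc (x, t).
  move=> c0 dz [->|->|/(coord_cyc HT) H''] cd; apply: gap; apply/(coord_cyc HT);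
    rewrite To /cyc; [lra|lra|rewrite /cyc in H''; lra].
have [yw|wy|/(coord_inj HT) -> //] := ltrgtP (T y) (T w).
  apply/esym; apply: displacement_vertical => // [|t Ht].
    by apply/(coord_cyc HT); rewrite To /cyc; lra.
  by apply: between Ht yw; lra.
apply: displacement_vertical => // [|t Ht].
  by apply/(coord_cyc HT); rewrite To /cyc; lra.
by apply: between Ht wy; lra.
Qed.

End bundle.

(** * Estimates of the displacement *)

Section dynamics.
Local Open Scope ring_scope.
Variables (R : realType) (S : surfaceGroup).
Variable (C : boundary S -> boundary S -> boundary S -> Prop).
Hypothesis HC : boundary_orientation R C.
Local Notation B := (boundary S).
Variables (g : S) (q p : B) (T : B -> R).
Hypotheses (Hg : fixed_pair g q p) (HT : coordinate C q T).
Implicit Types (x y z : B).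

Lemma open_arc x y : open [set w : B | C x w y].
Proof.
apply: (@open_orientation _ _ _ HC _ (fun=> x) id (fun=> y)).
- exact: cst_continuous.
- by move=> w; exact: cvg_id.
- exact: cst_continuous.
Qed.

Let To : T q = 0 := coord_base HT.

Let Tp : 0 < T p.
Proof. by apply: (coord_pos HT); have [/nesym] := Hg. Qed.

Lemma actVn_fix n : act (g ^- n)%g q = q /\ act (g ^- n)%g p = p.
Proof.
by have [_ gq gp _ _] := Hg; split; apply/actV_fix/act_expg_fix.
Qed.

Lemma actVSn n x : act (g ^- n.+1)%g x = act g^-1%g (act (g ^- n)%g x).
Proof. by rewrite -actM expgSr invgM. Qed.

Let lt_actV x y : 0 < T x -> T x < T y -> T (act g^-1%g x) < T (act g^-1%g y).
Proof.
move=> x0 xy; have : C q x y by apply/(coord_cyc HT); rewrite To /cyc; lra.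
have [_ /actV_fix gq _ _ _] := Hg.
move=> /(orientation_act HC g^-1%g); rewrite gq => /(coord_cyc HT).
have := coord_ge0 HT (act g^-1%g x); have := coord_ge0 HT (act g^-1%g y).
by rewrite To /cyc; lra.
Qed.

Let act_between n x : 0 < T x < T p -> 0 < T (act (g ^- n)%g x) < T p.
Proof.
move=> /andP[x0 xp]; have : C q x p by apply/(coord_cyc HT); rewrite To /cyc; lra.
have [gq gp] := actVn_fix n.
move=> /(orientation_act HC (g ^- n)%g); rewrite gq gp => /(coord_cyc HT).
by rewrite To /cyc; have := Tp; move=> *; apply/andP; lra.
Qed.

Let near_repelling z (U : set B) : z <> p -> open U -> U q ->
  exists n, U (act (g ^- n)%g z).
Proof.
move=> zp oU Uq; have [_ _ _ _ H] := Hg.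
by have [n _ /(_ n (leqnn n))] := H z zp U (open_nbhs_nbhs (conj oU Uq)); exists n.
Qed.

Lemma repel_below n x : 0 < T x < T p ->
  0 < T (act (g ^- n)%g x) /\ T (act (g ^- n)%g x) <= T x.
Proof.
move=> Hx; split; first by have /andP[] := act_between n Hx.
have step y : 0 < T y < T p -> T (act g^-1%g y) <= T y.
  move=> Hy; rewrite leNgt; apply/negP => up.
  have yp : y <> p by move=> E; move: Hy; rewrite E ltxx andbF.
  have far j : T y <= T (act (g ^- j)%g y).
    elim: j => [|j IH]; first by rewrite expg0 invg1 act1.
    rewrite actVSn; apply: le_trans (ltW up) _.
    move: IH; rewrite le_eqVlt => /orP[/eqP/(coord_inj HT) <- //|IH].
    by apply/ltW/lt_actV => //; case/andP: Hy.
  (* The arc from [p] to [y] contains [q], so the orbit of [y] must enter it; below [p] this means a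
     coordinate less than that of [y], against [far]. *)
  have [|||j Hj] := @near_repelling y [set w | C p w y] => //.
  - exact: open_arc.
  - by apply/(coord_cyc HT); rewrite To /cyc; case/andP: Hy; lra.
  have := far j; have /andP[? ?] := act_between j Hy.
  by move/(coord_cyc HT): Hj; case/andP: Hy; rewrite /cyc; lra.
elim: n => [|n IH]; first by rewrite expg0 invg1 act1.
by rewrite actVSn; apply: le_trans (step _ (act_between n Hx)) IH.
Qed.

(** On the other side of [p] the point [q] lies at infinity in the coordinate, so the same argument
    gives an increase. *)
Lemma repel_above n x : T p < T x -> T x <= T (act (g ^- n)%g x).
Proof.
move=> Hx.
have above j y : T p < T y -> T p < T (act (g ^- j)%g y).
  move=> yp; have : C q p y by apply/(coord_cyc HT); rewrite To /cyc; have := Tp; lra.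
  have [gq gp] := actVn_fix j.
  move=> /(orientation_act HC (g ^- j)%g); rewrite gq gp => /(coord_cyc HT).
  by rewrite To /cyc; have := coord_ge0 HT (act (g ^- j)%g y); have := Tp; lra.
have step y : T p < T y -> T y <= T (act g^-1%g y).
  move=> Hy; rewrite leNgt; apply/negP => down.
  have yp : y <> p by move=> E; move: Hy; rewrite E ltxx.
  have far j : T (act (g ^- j)%g y) <= T y.
    elim: j => [|j IH]; first by rewrite expg0 invg1 act1.
    rewrite actVSn; apply: le_trans (ltW down).
    move: IH; rewrite le_eqVlt => /orP[/eqP/(coord_inj HT) -> //|IH].
    by apply/ltW/lt_actV => //; apply: lt_trans Tp (above _ _ Hy).
  have [|||j Hj] := @near_repelling y [set w | C y w p] => //.
  - exact: open_arc.
  - by apply/(coord_cyc HT); rewrite To /cyc; have := Tp; lra.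
  have := far j; have := above j _ Hy.
  by move/(coord_cyc HT): Hj; rewrite /cyc; lra.
elim: n => [|n IH]; first by rewrite expg0 invg1 act1.
by rewrite actVSn; apply: le_trans IH (step _ (above _ _ Hx)).
Qed.

End dynamics.

(** * Comparison of displacements along horizontal segments *)

Section estimates.
Local Open Scope ring_scope.
Variables (R : realType) (S : surfaceGroup).
Variable (C : boundary S -> boundary S -> boundary S -> Prop).
Hypothesis HC : boundary_orientation R C.
Variable P : taxiBundle C R.
Variables (v u : pairs S -> P) (nu nub : {measure set (borel_pairs S) -> \bar R}).
Hypotheses (vfl : vertical_flat v) (ufl : horizontal_flat u).
Hypothesis nu_fin : forall p, Gcirc p -> nu (G_ge C p) \is a fin_num.
Hypothesis nub_fin : forall p, Gcirc p -> nub (G_le C p) \is a fin_num.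
Local Notation N p := (fine (nu (G_ge C p))).
Local Notation Nb p := (fine (nub (G_le C p))).
Hypothesis uv : forall p, Gcirc p -> u p = fshift (v p) (- N p - Nb p).
Local Notation B := (boundary S).
Implicit Types (x y z a b o : B) (k : S).

Let mge p := measurable_G_ge HC p.
Let mle p := measurable_G_le HC p.

Let N_ge0 p : 0 <= N p. Proof. exact/fine_ge0/measure_ge0. Qed.
Let Nb_ge0 p : 0 <= Nb p. Proof. exact/fine_ge0/measure_ge0. Qed.

Let N_mono x x' y : C x x' y -> Gcirc (x', y) -> N (x, y) <= N (x', y).
Proof. by move=> H G; apply: fine_measure_le => //; [exact: nu_fin|exact: (G_ge_sub HC)]. Qed.

Let Nb_mono x x' y : C x x' y -> Gcirc (x, y) -> Nb (x', y) <= Nb (x, y).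
Proof. by move=> H G; apply: fine_measure_le => //; [exact: nub_fin|exact: (G_le_sub HC)]. Qed.

Let horizontal k x x' y : generic y -> C y x x' ->
  displacement k v (x, y) - N (act k^-1%g x, act k^-1%g y) - Nb (act k^-1%g x, act k^-1%g y)
    + N (x, y) + Nb (x, y) =
  displacement k v (x', y) - N (act k^-1%g x', act k^-1%g y) - Nb (act k^-1%g x', act k^-1%g y)
    + N (x', y) + Nb (x', y).
Proof.
move=> gy yxx'; have := displacement_horizontal HC k vfl ufl uv yxx'.
rewrite /act2 /= => H; have : forall z : B, carc C x x' z -> Gcirc (z, y).
  by move=> z /(carc_base_neq HC yxx') zy; exact: generic_Gcirc_r.
by move=> /H; lra.
Qed.

Let Gc k x y : generic y -> x <> y -> Gcirc (act k^-1%g x, act k^-1%g y).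
Proof. by move=> gy xy; apply: (Gcirc_act P k^-1%g (p := (x, y))); exact: generic_Gcirc_r. Qed.

(** In [D(x, y) - D(q, y)] the terms in [N] are the mass of a strip at the image under [k^-1] minus
    that of the strip at (x, y), hence at most 0. The terms in [Nb] at the image are at most 0 by
    monotonicity, and dropping [- Nb (x, y)] leaves [Nb (q, y)]. *)
Lemma displacement_le_above k q x y (T : B -> R) : coordinate C q T ->
  act k^-1%g q = q -> generic y ->
  0 < T (act k^-1%g x) -> T (act k^-1%g x) <= T x -> T x < T y -> T y <= T (act k^-1%g y) ->
  displacement k v (x, y) <= displacement k v (q, y) + Nb (q, y).
Proof.
move=> HT kq gy h1 h2 h3 h4; have To := coord_base HT.
have neq a b : T a < T b -> a <> b by move=> /[swap] ->; rewrite ltxx.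
have xy : x <> y by exact: neq.
have qy : q <> y by apply: neq; lra.
have := @horizontal k q x y gy; rewrite kq.
have Cyqx : C y q x by apply/(coord_cyc HT); rewrite To /cyc; lra.
have Ckqx : C q (act k^-1%g x) (act k^-1%g y).
  by apply/(coord_cyc HT); rewrite To /cyc; lra.
have Cqxy : C q x y by apply/(coord_cyc HT); rewrite To /cyc; lra.
have Gk := Gc k gy xy; have Gkq := Gc k gy qy; rewrite kq in Gkq.
have Gx := generic_Gcirc_r gy xy; have Gq := generic_Gcirc_r gy qy.
move=> /(_ Cyqx) E.
have := fine_measure_diff_le (mge _) (mge _) (mge _) (mge _) (nu_fin Gk) (nu_fin Gx)
  (G_ge_sub HC Ckqx) (G_ge_sub HC Cqxy) (G_ge_strip HT h1 h2 h3 h4).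
by have := Nb_mono Ckqx Gkq; have := Nb_ge0 (x, y); lra.
Qed.

(** Now the arc from [x] to [y] contains [q], which exchanges the roles of [N] and [Nb]: the strips
    are those of [G_le], and [N (q, y)] is left over. *)
Lemma displacement_le_below k q x y (T : B -> R) : coordinate C q T ->
  act k^-1%g q = q -> generic y ->
  0 < T (act k^-1%g y) -> T (act k^-1%g y) <= T y -> T y < T x -> T x <= T (act k^-1%g x) ->
  displacement k v (x, y) <= displacement k v (q, y) + N (q, y).
Proof.
move=> HT kq gy h1 h2 h3 h4; have To := coord_base HT.
have neq a b : T a < T b -> b <> a by move=> /[swap] ->; rewrite ltxx.
have xy : x <> y by exact: neq.
have qy : q <> y by apply/nesym/neq; lra.
have := @horizontal k x q y gy; rewrite kq.
have Cyqx : C y x q by apply/(coord_cyc HT); rewrite To /cyc; lra.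
have Ckqx : C (act k^-1%g x) q (act k^-1%g y).
  by apply/(coord_cyc HT); rewrite To /cyc; lra.
have Cqxy : C x q y by apply/(coord_cyc HT); rewrite To /cyc; lra.
have Gk := Gc k gy xy; have Gkq := Gc k gy qy; rewrite kq in Gkq.
have Gx := generic_Gcirc_r gy xy; have Gq := generic_Gcirc_r gy qy.
move=> /(_ Cyqx) E.
have := fine_measure_diff_le (mle _) (mle _) (mle _) (mle _) (nub_fin Gk) (nub_fin Gx)
  (G_le_sub HC Ckqx) (G_le_sub HC Cqxy) (G_le_strip HT h1 h2 h3 h4).
by have := N_mono Ckqx Gkq; have := N_ge0 (x, y); lra.
Qed.

(** A generic [y] is fixed first, so close to [x] that the image of (x, y) has little mass [Nb];
    then a generic [x'] between [x] and [y] with [N (x', y)] close to [N (x, y)]. In the horizontal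
    comparison of (x, y) and (x', y) each of these costs [e / 2], and all other terms have the right
    sign. *)
Lemma displacement_right_limit k x z (M e : R) : z <> x ->
  (forall y, C x y z -> Gcirc (x, y)) ->
  (forall a b, generic a -> b <> a -> displacement k v (a, b) <= M) -> 0 < e ->
  exists2 y, C x y z & displacement k v (x, y) <= M + e.
Proof.
move=> zx gap bound e0; have e2 : 0 < e / 2 by rewrite divr_gt0.
have [w [gw wx dec cof]] := generic_sequence HC x.
have [j0 Hj0] := cof z zx.
pose y j := w (j0 + j)%N.
have yz j : C x (y j) z by apply: Hj0; rewrite leq_addr.
have [j Hj] : exists j, Nb (act k^-1%g x, act k^-1%g (y j)) < e / 2.
  have := @measure_bigcap_lt _ _ _ nub
    (fun j => G_le C (act k^-1%g x, act k^-1%g (y j))) set0 (e / 2).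
  rewrite measure0 /= add0r; apply => //.
  - apply: nub_fin; apply: (Gcirc_act P k^-1%g (p := (x, y 0%N))); exact: gap.
  - move=> i i' ii'; apply: (G_le_subr HC); apply/(orientation_act HC).
    by apply: dec; rewrite ltn_add2l.
  apply: (bigcap_G_le HC) => b bx.
  have /cof[i Hi] : act k b <> x by move=> E; apply: bx; rewrite -E actK.
  exists i; rewrite -[b in C _ _ b](actK k); apply/(orientation_act HC).
  by apply: Hi; rewrite leq_addl.
(* The tail of the same sequence beyond [y j] lies strictly between [x] and [y j]. *)
pose x' i := w (j0 + j + i.+1)%N.
have x'y i : C x (x' i) (y j) by apply: dec; rewrite addnS ltnS leq_addr.
have x'x i i' : (i < i')%N -> C x (x' i') (x' i).
  by move=> ii'; apply: dec; rewrite ltn_add2l.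
have neq a b c : C a b c -> b <> c by move=> /(orientation_neq HC)[].
have gy : generic (y j) by exact: gw.
have [i Hi] : exists i, N (x' i, y j) < N (x, y j) + e / 2.
  apply: (@measure_bigcap_lt _ _ _ nu (fun i => G_ge C (x' i, y j))) => //.
  - by apply: nu_fin; apply: generic_Gcirc_r => //; exact: neq (x'y _).
  - move=> i i' ii'; apply: (G_ge_sub HC).
    have [T HT] := ex_coordinate HC x.
    have := coord_ge0 HT (x' i'); have := coord_ge0 HT (x' i).
    move/(coord_cyc HT): (x'x _ _ ii'); move/(coord_cyc HT): (x'y i).
    by rewrite (coord_base HT) => c1 c2 *; apply/(coord_cyc HT); rewrite /cyc in c1 c2 *; lra.
  apply: (bigcap_G_ge HC) => // b bx; have [i Hi] := cof b bx.
  by exists i; apply: Hi; rewrite /x' addnS -addSn leq_addl.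
exists (y j) => //.
have Cyxx : C (y j) x (x' i) by apply/(orientation_rot HC)/(orientation_rot HC)/x'y.
have E := horizontal k gy Cyxx.
have := bound _ (y j) (gw _ : generic (x' i)) (nesym (neq _ _ _ (x'y i))).
have Ck : C (act k^-1%g x) (act k^-1%g (x' i)) (act k^-1%g (y j)).
  exact/(orientation_act HC).
have x'yj := neq _ _ _ (x'y i).
have xyj : x <> y j by move=> /esym/wx.
have := N_mono Ck (Gc k gy x'yj).
have := Nb_mono (x'y i) (generic_Gcirc_r gy xyj).
have := Nb_ge0 (act k^-1%g (x' i), act k^-1%g (y j)).
lra.
Qed.

End estimates.

(** * The translation length *)

Section translation_length.
Local Open Scope ring_scope.
Variables (R : realType) (S : surfaceGroup).
Hypothesis hyp : gromov_hyperbolic S.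
Variable (C : boundary S -> boundary S -> boundary S -> Prop).
Hypothesis HC : boundary_orientation R C.
Variable P : taxiBundle C R.
Local Notation B := (boundary S).
Implicit Types (x y a b o : B).

(** Since [m] is real and both masses are nonnegative, neither mass can be infinite, so [m] can be
    computed in the reals. *)
Lemma in_LP_measures (mu : {measure set (borel_pairs S) -> \bar R}) (L : triple P) :
  in_LP mu L -> exists nu nub : {measure set (borel_pairs S) -> \bar R},
  forall p, Gcirc p -> [/\ nu (G_ge C p) \is a fin_num, nub (G_le C p) \is a fin_num &
    tr_u L p = fshift (tr_v L p) (- fine (nu (G_ge C p)) - fine (nub (G_le C p)))].
Proof.
move=> [[[[[nu Hnu] _ _] _] _] _ _ [nub [_ H]]]; exists nu, nub => p /H[m].
rewrite Hnu; last exact: (measurable_G_ge HC).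
have := measure_ge0 nu (G_ge C p); have := measure_ge0 nub (G_le C p).
by case: (nu _) (nub _) => [r| |] [s| |] //= _ _ [->].
Qed.

Lemma carcxx a z : carc C a a z <-> z = a.
Proof.
split=> [[] // H|->]; last by constructor 1.
have [T HT] := ex_coordinate HC a.
by exfalso; move/(coord_cyc HT): H; rewrite /cyc; lra.
Qed.

(** The only horizontal segments inside a vertical line are single points, which are also degenerate
    vertical segments. Thus [v] is flat in the sense used for periods. *)
Lemma vertical_line_flat q (v : pairs S -> P) (A : set (pairs S)) :
  vertical_flat v -> A `<=` @Gcirc S -> (forall z, A z -> z.1 = q) ->
  flat_section A v.
Proof.
move=> [sec fl] sub Aq; split; first by move=> z /sub; exact: sec.
move=> p p' A' [] sA A'A A'G; last exact: fl sA A'G.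
case: sA A'A A'G => x x' y xy x'y _ A'A A'G.
have xq : x = q by apply: (Aq (x, y)); apply: A'A; split => //; constructor 1.
have x'q : x' = q by apply: (Aq (x', y)); apply: A'A; split => //; constructor 2.
have eqA : carc C x x' `*` [set y] = [set q] `*` carc C y y.
  rewrite xq x'q; apply/seteqP; split=> -[a b] [/= H1 H2]; split => /=.
  - exact/carcxx.
  - exact/carcxx.
  - exact/carcxx.
  - exact/carcxx.
rewrite eqA in A'G *; apply: (fl (q, y) (q, y)) => //.
by rewrite xq in xy; constructor; [exact/nesym|exact/nesym|left].
Qed.

Lemma displacement_period (g : S) q p (l : R) (v : pairs S -> P) (A : set (pairs S)) n :
  vertical_flat v -> fixed_pair g q p ->
  A = [set z | z.1 = q /\ C p z.2 q] \/ A = [set z | z.1 = q /\ C q z.2 p] ->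
  (forall A (s : pairs S -> P), ray4 C q p A -> flat_section A s ->
    forall z : pairs S, A z -> act_section g s z = fshift (s z) l) ->
  forall z, A z -> displacement (g ^+ n)%g v z = n%:R * l.
Proof.
move=> vfl Hg HA Hl; have [qp gq gp _ _] := Hg.
have subA : A `<=` @Gcirc S.
  move=> [x y] Az; have [-> [yq yp]] : x = q /\ q <> y /\ y <> p.
    by case: HA Az => -> [/= -> /(orientation_neq HC)[? ?]]; split=> //; split=> //; exact/nesym.
  by split => //= -[h h1 Hh]; apply: yp; exact: (fixed_pair_inj HC hyp Hh Hg).
have Aq z : A z -> z.1 = q by case: HA => -> [].
have rayA : ray4 C q p A by case: HA => ->; [constructor 1|constructor 2].
have Hv := Hl A v rayA (vertical_line_flat vfl subA Aq).
(* The ray is invariant, so the period equation for [g] can be iterated. *)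
have gA z : A z -> A (act2 g^-1%g z).
  by case: HA => -> [/= z1 /(orientation_act HC g^-1%g)];
    rewrite (actV_fix gp) (actV_fix gq) => z2; split => //=; rewrite z1 (actV_fix gq).
move=> z Az; suff H : act_section (g ^+ n)%g v z = fshift (v z) (n%:R * l).
  by rewrite /displacement H sub_fiberE.
elim: n z Az => [|n IH] z Az.
  rewrite mul0r Defs.shift0 /act_section expg0 lift_act1 invg1.
  by case: z {Az} => a b; rewrite /act2 /= !act1.
rewrite expgS act_sectionM {1}/act_section IH; last exact: gA.
rewrite shift_act -[lift_act g _]/(act_section g v z) Hv // shiftD -natr1.
by congr (fshift _ _); ring.
Qed.

Lemma ereal_sup_linear (F : nat -> B -> R) (q : B) (l K : R) :
  (forall n, F n q = n%:R * l) -> (forall n x, F n x <= n%:R * l + K) ->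
  ((fun n : nat => ereal_sup [set (F n x)%:E | x in [set: B]] * (n%:R^-1)%:E)
    @ \oo --> l%:E)%E.
Proof.
(* The shift discards the term 0, where the inverse of 0 has its default value. The two bounds also
   rule out an infinite supremum. *)
move=> lo up; rewrite -cvg_shiftS.
have lo' n : (((n%:R * l)%:E <= ereal_sup [set (F n x)%:E | x in [set: B]]))%E.
  by apply: ereal_sup_ubound; exists q; rewrite ?lo.
have up' n : ((ereal_sup [set (F n x)%:E | x in [set: B]] <= (n%:R * l + K)%:E))%E.
  by apply: ge_ereal_sup => _ [x _ <-]; rewrite lee_fin.
have n0 n : n.+1%:R != 0 :> R by rewrite pnatr_eq0.
have between : \forall n \near \oo, (l%:E <=
    ereal_sup [set (F n.+1 x)%:E | x in [set: B]] * (n.+1%:R^-1)%:E <=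
    (l + K * n.+1%:R^-1)%:E)%E.
  near=> n; move: (lo' n.+1) (up' n.+1).
  case: (ereal_sup _) => [r| |]; rewrite ?leye_eq ?leeNy_eq //.
  rewrite !lee_fin => h1 h2;
  rewrite ler_pdivlMr // ler_pdivrMr // mulrDl mulfVK // (mulrC l).
  by rewrite h1 h2.
apply: (@squeeze_cvge _ _ _ _ _ _ _ between l%:E); first exact: cvg_cst.
apply: cvg_EFin; first by near=> n.
rewrite -[X in _ --> X]addr0 -(mulr0 K); apply: cvgD; first exact: cvg_cst.
by apply: cvgM; [exact: cvg_cst|exact: cvg_harmonic].
Unshelve. all: by end_near. Qed.

Lemma period_translation_length (mu : {measure set (borel_pairs S) -> \bar R})
  (g : S) (g_nontrivial : g <> 1%g) (l : R) :
  is_period P g l -> is_translation_length P mu g l.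
Proof.
move=> [q [p [Hg Hl]]] L HL.
have [qp gq gp _ _] := Hg.
have [_ vfl ufl _] := HL.
have [nu [nub Huv]] := in_LP_measures HL.
have nu_fin z : Gcirc z -> nu (G_ge C z) \is a fin_num by move=> /Huv[].
have nub_fin z : Gcirc z -> nub (G_le C z) \is a fin_num by move=> /Huv[].
have uv z : Gcirc z -> tr_u L z =
    fshift (tr_v L z) (- fine (nu (G_ge C z)) - fine (nub (G_le C z))) by move=> /Huv[].
have [T HT] := ex_coordinate HC q; have To := coord_base HT.
have Tp : 0 < T p by apply: (coord_pos HT); exact/nesym.
(* The reference heights are [y1] between [p] and [q] and [y2] between [q] and [p]; for each, (q, y)
   lies on one of the vertical rays over [q]. *)
have [||y1 gy1 /andP[y1p _]] := @generic_dense _ _ _ HC _ _ HT (T p) (T p + 1).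
- exact: ltW.
- by rewrite ltrDl.
have [||y2 gy2 /andP[y20 y2p]] := @generic_dense _ _ _ HC _ _ HT 0 (T p) => //.
have disp1 n : displacement (g ^+ n)%g (tr_v L) (q, y1) = n%:R * l.
  apply: (displacement_period n vfl Hg (or_introl erefl) Hl); split => //=.
  by apply/(coord_cyc HT); rewrite To /cyc; lra.
have disp2 n y : 0 < T y -> T y < T p -> displacement (g ^+ n)%g (tr_v L) (q, y) = n%:R * l.
  move=> y0 yp.
  apply: (displacement_period n vfl Hg (or_intror erefl) Hl); split => //=.
  by apply/(coord_cyc HT); rewrite To /cyc; lra.
pose K := fine (nub (G_le C (q, y1))) + fine (nu (G_ge C (q, y2))).
have Nb0 : 0 <= fine (nub (G_le C (q, y1))) by exact/fine_ge0/measure_ge0.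
have N0 : 0 <= fine (nu (G_ge C (q, y2))) by exact/fine_ge0/measure_ge0.
have fixV n : act ((g ^+ n)^-1)%g q = q by exact/actV_fix/act_expg_fix.
have bound n x y : generic x -> y <> x ->
    displacement (g ^+ n)%g (tr_v L) (x, y) <= n%:R * l + K.
  move=> gx yx; have [xq xp] := gx _ _ _ g_nontrivial Hg.
  (* Over a generic [x] the whole vertical line is available, so the height can be changed to [y1]
     or [y2], whichever makes the strips shrink. *)
  have indep z : z <> x ->
      displacement (g ^+ n)%g (tr_v L) (x, y) = displacement (g ^+ n)%g (tr_v L) (x, z).
    move=> zx; have [U HU] := ex_coordinate HC x.
    have Uy := coord_pos HU yx; have Uz := coord_pos HU zx; have Ux := coord_base HU.
    have [yz|zy|/(coord_inj HU) -> //] := ltrgtP (U y) (U z).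
      apply: (displacement_generic HC) => //.
      by apply/(coord_cyc HU); rewrite Ux /cyc; lra.
    apply/esym; apply: (displacement_generic HC) => //.
    by apply/(coord_cyc HU); rewrite Ux /cyc; lra.
  have Tx := coord_pos HT xq.
  have neq a b : T a < T b -> a <> b /\ b <> a.
    by move=> H; split=> E; move: H; rewrite E ltxx.
  have [xltp|pltx|/(coord_inj HT) //] := ltrgtP (T x) (T p).
    have xy1 := lt_trans xltp y1p.
    rewrite (indep y1); last by have [] := neq _ _ xy1.
    have [|r1 r2] := repel_below HC Hg HT n (x := x); first by rewrite Tx.
    have := displacement_le_above HC vfl ufl nu_fin nub_fin uv HT (fixV n) gy1
      r1 r2 xy1 (repel_above HC Hg HT n y1p).
    by rewrite disp1 /K; lra.
  have y2x := lt_trans y2p pltx.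
  rewrite (indep y2); last by have [] := neq _ _ y2x.
  have [|r1 r2] := repel_below HC Hg HT n (x := y2); first by rewrite y20.
  have := displacement_le_below HC vfl ufl nu_fin nub_fin uv HT (fixV n) gy2
    r1 r2 y2x (repel_above HC Hg HT n pltx).
  by rewrite disp2 // /K; lra.
apply: (@ereal_sup_linear (fun n => f_LP L (act_triple (g ^+ n)%g L)) q l K).
(* The value at [x = q] is exactly [n l], which gives the lower bound for the supremum. *)
- move=> n; have Cqy2p : C q y2 p by apply/(coord_cyc HT); rewrite To /cyc; lra.
  have gap w : C q w p -> Gcirc (q, w).
    move=> H; have [qw wp] := orientation_neq HC H.
    by split => //= -[h _ Hh]; apply: wp; exact: (fixed_pair_inj HC hyp Hh Hg).
  by rewrite (f_LP_displacement HC _ vfl gap Cqy2p) disp2.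
(* For arbitrary [x] the bound at generic points passes to the limit from the right, up to [e]. *)
- move=> n x; apply/ler_addgt0Pr => e e0.
  have [z [zx gap]] := exists_gap HC hyp x.
  have [y Cxyz le] := displacement_right_limit HC vfl ufl nu_fin nub_fin uv zx gap
    (bound n) e0.
  by rewrite (f_LP_displacement HC _ vfl gap Cxyz).
Qed.

End translation_length.

Theorem lemma5p18 (R : realType) (S : surfaceGroup)
  (S_hyperbolic : gromov_hyperbolic S)
  (C : boundary S -> boundary S -> boundary S -> Prop)
  (C_orientation : boundary_orientation R C)
  (P : taxiBundle C R) (P_nonneg : nonneg_holonomy P)
  (mu : {measure set (borel_pairs S) -> \bar R}%R)
  (mu_current : geodesic_current mu) (mu_curvature : is_curvature P mu)
  (g : S) (g_nontrivial : g <> 1%g)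
  (l : R) (l_period : is_period P g l) :
  is_translation_length P mu g l.
Proof.
exact: (period_translation_length S_hyperbolic C_orientation g_nontrivial l_period).
Qed.
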